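(* Let $n$ and $m$ be positive integers. Let $\mathbf{c}\in\mathbb{Z}[t]^n$, $A\in\mathbb{Z}[t]^{m\times n}$ and $\mathbf{b}\in\mathbb{Z}[t]^m$. For every positive integer $t$, let $R(t):=\{\mathbf{x}\in\mathbb{R}^n \mid A(t)\mathbf{x}\le \mathbf{b}(t)\}$ and $L(t):=R(t)\cap\mathbb{Z}^n$. Assume that $R(t)$ is bounded for all positive integers $t$. For all positive integers $\ell$, let $f_\ell(t)$ be the $\ell^{\text{th}}$ largest value (with multiplicity) of $\mathbf{c}^{\intercal}(t)\mathbf{x}$ for $\mathbf{x}\in L(t)$, or $-\infty$ if $|L(t)|<\ell$. Then for all positive integers $\ell$, $f_\ell$ is eventually quasi-polynomial.
   Context: Inequalities between vectors are coordinate-wise. The variables $t$ and $\ell$ range over positive integers. The $\ell^{\text{th}}$ largest value with multiplicity means the $\ell^{\text{th}}$ largest element of the multiset $\{\mathbf{c}^{\intercal}(t)\mathbf{x} : \mathbf{x}\in L(t)\}$ (one entry for each $\mathbf{x}\in L(t)$). A function $g$ is eventually quasi-polynomial if its domain is a subset of $\mathbb{Z}$ containing all sufficiently large integers and there exist a positive integer $d$ and polynomials $P_0,\ldots,P_{d-1}\in\mathbb{R}[t]$ such that for all sufficiently large $t$, $g(t)=P_{t \bmod d}(t)$. By convention the constant function $-\infty$ counts as a polynomial, so each $P_j$ is allowed to be the constant $-\infty$. *)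

(* Defs.v *)
From HB Require Import structures.
From mathcomp Require Import all_boot all_order all_algebra finmap.
From mathcomp Require Import all_classical all_reals all_analysis.

Set Implicit Arguments.
Unset Strict Implicit.
Unset Printing Implicit Defensive.

Import Order.TTheory GRing.Theory Num.Theory.
Import numFieldNormedType.Exports.

Local Open Scope classical_set_scope.
Local Open Scope ring_scope.

Definition eval_mx (R : realType) (m n : nat) (M : 'M[{poly int}]_(m, n))
  (t : int) : 'M[R]_(m, n) := \matrix_(i, j) (M i j).[t]%:~R.
Arguments eval_mx R {m n} M t.

Definition polyhedron (R : realType) (m n : nat) (A : 'M[{poly int}]_(m, n))
    (b : 'cV[{poly int}]_m) (t : int) : set 'cV[R]_n :=
  [set x | forall i : 'I_m, (eval_mx R A t *m x) i 0 <= eval_mx R b t i 0].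
Arguments polyhedron R {m n} A b t.

Definition integer_points (R : realType) (n : nat) : set 'cV[R]_n :=
  [set x | forall i : 'I_n, x i 0 \is a Num.int].
Arguments integer_points : clear implicits.

Definition lattice_points (R : realType) (m n : nat)
    (A : 'M[{poly int}]_(m, n)) (b : 'cV[{poly int}]_m) (t : int) :
    set 'cV[R]_n :=
  polyhedron R A b t `&` integer_points R n.
Arguments lattice_points R {m n} A b t.

Definition objective (R : realType) (n : nat) (c : 'cV[{poly int}]_n)
  (t : int) (x : 'cV[R]_n) : R := ((eval_mx R c t)^T *m x) 0 0.

(* The multiset of objective values on S, one entry per point of S, in
   nonincreasing order; fset_set S enumerates S only when S is finite. *)
Definition sorted_values (T : choiceType) (R : realType) (h : T -> R)
  (S : set T) : seq R := sort >=%R [seq h x | x <- fset_set S].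

Definition kth_largest (T : choiceType) (R : realType) (h : T -> R)
  (S : set T) (l : nat) : \bar R :=
  nth -oo%E [seq v%:E | v <- sorted_values h S] l.-1.

Definition param_kth_largest (R : realType) (m n : nat)
    (c : 'cV[{poly int}]_n) (A : 'M[{poly int}]_(m, n))
    (b : 'cV[{poly int}]_m) (l : nat) (t : int) : \bar R :=
  kth_largest (objective c t) (lattice_points R A b t) l.
Arguments param_kth_largest R {m n} c A b l t.

(* None stands for the constant "polynomial" -oo. *)
Definition ext_horner (R : realType) (p : option {poly R}) (x : R) : \bar R :=
  if p is Some q then q.[x]%:E else -oo%E.

(* A function with domain D is a total function whose values outside D are
   irrelevant. *)
Definition eventually_quasi_polynomial (R : realType) (D : set int)
    (g : int -> \bar R) : Prop :=
  (exists N : int, forall t : int, N <= t -> D t) /\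
  exists (d : nat) (P : 'I_d -> option {poly R}),
    (0 < d)%N /\
    exists N : int, forall t : int, N <= t -> D t ->
      forall j : 'I_d, (t %% d%:Z)%Z = j%:Z -> g t = ext_horner (P j) t%:~R.

(* Main.v *)
(** The digits in base t of a bounded integer point turn an inequality with
coefficients in Z[t] into finitely many alternatives between systems with
constant coefficients: only boundedly many carries occur, so one can branch on
all of them. Over such a system, Fourier-Motzkin elimination is exact on Z once
the variables are restricted to residue classes modulo a common multiple of the
pivots; hence the largest leading digit of the objective is eventually affine
in t on residue classes. Substituting it removes a variable, and the digits of
the maximum are found one after the other.

The bound on the points needed for digits of bounded length comes from real
Fourier-Motzkin elimination with coefficients in Z[t], whose pivots have an
eventually constant sign. The l-th largest value is the largest v for which
there are l distinct lattice points of value at least v; distinctness is a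
finite disjunction of strict inequalities between coordinates. *)
Require Import Defs.
From HB Require Import structures.
From mathcomp Require Import all_boot all_order all_algebra.
From mathcomp Require Import all_classical all_reals all_analysis.
From mathcomp Require Import zify ring lra.
Import Order.TTheory GRing.Theory Num.Theory.
Import numFieldNormedType.Exports.
Local Open Scope classical_set_scope.
Local Open Scope ring_scope.

Set Implicit Arguments.
Unset Strict Implicit.
Unset Printing Implicit Defensive.

(** * Affine forms and exact elimination over the integers *)

(* Affine forms are encoded as polynomials: the coefficient of index 0 is the
   constant term, the one of index i.+1 multiplies the variable i. *)
Definition lin (K : comNzRingType) n (a : {poly K}) (x : nat -> K) : K :=
  a`_0 + \sum_(i < n) a`_i.+1 * x i.

Lemma eq_lin (K : comNzRingType) n (a : {poly K}) x y :
  (forall i, (i < n)%N -> x i = y i) -> lin n a x = lin n a y.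
Proof. by move=> xy; congr (_ + _); apply: eq_bigr => i _; rewrite xy. Qed.

Lemma lin_recr (K : comNzRingType) n (a : {poly K}) x :
  lin n.+1 a x = lin n a x + a`_n.+1 * x n.
Proof. by rewrite /lin big_ord_recr addrA. Qed.

Lemma linC (K : comNzRingType) n (c : K) x : lin n c%:P x = c.
Proof.
rewrite /lin coefC big1 ?addr0// => i _; by rewrite coefC mul0r.
Qed.

Lemma linX (K : comNzRingType) n i (x : nat -> K) :
  (i < n)%N -> lin n 'X^(i.+1) x = x i.
Proof.
move=> ltin; rewrite /lin coefXn add0r (bigD1 (Ordinal ltin)) //=.
rewrite coefXn eqxx mul1r big1 ?addr0// => j /eqP ji.
rewrite coefXn; case: eqP => [[] e|_]; last by rewrite mul0r.
by case: ji; apply: val_inj.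
Qed.

Lemma linD (K : comNzRingType) n (a b : {poly K}) x :
  lin n (a + b) x = lin n a x + lin n b x.
Proof.
rewrite /lin coefD addrACA -big_split; congr (_ + _).
by apply: eq_bigr => i _; rewrite coefD mulrDl.
Qed.

Lemma linZ (K : comNzRingType) n c (a : {poly K}) x :
  lin n (c *: a) x = c * lin n a x.
Proof.
rewrite /lin coefZ mulrDr mulr_sumr; congr (_ + _).
by apply: eq_bigr => i _; rewrite coefZ mulrA.
Qed.

Lemma linN (K : comNzRingType) n (a : {poly K}) x : lin n (- a) x = - lin n a x.
Proof. by rewrite -scaleN1r linZ mulN1r. Qed.

Lemma linB (K : comNzRingType) n (a b : {poly K}) x :
  lin n (a - b) x = lin n a x - lin n b x.
Proof. by rewrite linD linN. Qed.

Lemma lin_sum (K : comNzRingType) n I r (P : pred I) (a : I -> {poly K}) x :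
  lin n (\sum_(i <- r | P i) a i) x = \sum_(i <- r | P i) lin n (a i) x.
Proof.
elim/big_rec2: _ => [|i y1 y2 _ <-]; first by rewrite -[0]/0%:P linC.
by rewrite linD.
Qed.

Definition subst_form (K : comNzRingType) n (f : nat -> {poly K}) (a : {poly K}) :=
  (a`_0)%:P + \sum_(i < n) a`_i.+1 *: f i.

Lemma lin_subst (K : comNzRingType) m n (f : nat -> {poly K}) a x :
  lin m (subst_form n f a) x = lin n a (fun i => lin m (f i) x).
Proof.
rewrite linD linC lin_sum; congr (_ + _).
by apply: eq_bigr => i _; rewrite linZ.
Qed.

Lemma ex_between (T : realDomainType) (ls us : seq T) :
  (exists y, all (fun l => l <= y) ls /\ all (fun u => y <= u) us) <->
  allrel <=%R ls us.
Proof.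
split=> [[y [/allP ly /allP yu]]|/allrelP lu].
  by apply/allrelP => l u lls uus; apply: le_trans (ly _ lls) (yu _ uus).
have ex_max (s : seq T) : s != [::] -> exists2 m, m \in s & all (fun l => l <= m) s.
  elim: s => // a [|b s] IHs _.
    by exists a; rewrite ?mem_head//= lexx.
  have [//|m ms ml] := IHs.
  have allE z : all (fun l => l <= z) [:: a, b & s] =
    (a <= z) && all (fun l => l <= z) (b :: s) by [].
  have [am|ma] := leP a m.
    by exists m; [rewrite in_cons ms orbT | rewrite allE am].
  exists a; first exact: mem_head.
  by rewrite allE lexx; apply: sub_all ml => l lm; rewrite (le_trans lm)// ltW.
case: (eqVneq ls [::]) => [-> | /ex_max[m mls lm]]; last first.
  by exists m; split=> //; apply/allP => u uus; apply: lu.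
(* Without lower bounds, the least upper bound is a witness, found as the opposite of the largest
   negated one; without any bound, 0 is one. *)
case: (eqVneq (map -%R us) [::]) => [/eqP|/ex_max[m mus lm]].
  by rewrite -size_eq0 size_map size_eq0 => /eqP->; exists 0.
exists (- m); split=> //; apply/allP => u uus.
by rewrite lerNl (allP lm)// map_f.
Qed.

Notation sol n S x := (all (fun a => 0 <= lin n a x) S).

Definition extend (K : Type) n (x : nat -> K) (y : K) : nat -> K :=
  fun i => if (i < n)%N then x i else y.

Lemma lin_extend (K : comNzRingType) n (a : {poly K}) x y :
  lin n.+1 a (extend n x y) = lin n a x + a`_n.+1 * y.
Proof.
rewrite lin_recr {2}/extend ltnn; congr (_ + _).
by apply: eq_lin => i; rewrite /extend => ->.
Qed.

Lemma lin_dilate n (a : {poly int}) (L : int) rho x :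
  lin n a (fun i => L * x i + rho i) = lin n a rho + L * (lin n a x - a`_0).
Proof.
rewrite /lin [_ - _]addrC addKr mulr_sumr -addrA -big_split; congr (_ + _).
by apply: eq_bigr => i _ /=; ring.
Qed.

(** Write [e] for the last coefficient and [k] for [lin n a rho]. As [e] divides [L], the dilated
    form is [e] times an integral form in [x] and [y], plus [k]. For [e > 0], replacing [k] by [e]
    times its floor quotient leaves a remainder in [[0, e)], which does not affect the sign
    condition; for [e < 0], use [- e]. *)
Lemma split_bound1 n (a : {poly int}) (L : int) rho :
  (a`_n.+1 != 0 -> (a`_n.+1 %| L)%Z) ->
  exists ls us cs, forall x y,
    (0 <= lin n.+1 a (extend n (fun i => L * x i + rho i) y)) =
    [&& all (fun l => lin n l x <= y) ls, all (fun u => y <= lin n u x) us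
      & sol n cs x].
Proof.
move=> dvdL; set e := a`_n.+1; set k := lin n a rho.
have eqv (e' w r : int) : 0 <= r < e' -> (0 <= e' * w + r) = (0 <= w) by nia.
case: (ltgtP e 0) => [lt0|gt0|e0].
- have /dvdL/dvdzP[q Lq] : e != 0 by rewrite lt_eqF.
  exists [::], [:: (- q) *: (a - (a`_0)%:P) + ((k %/ - e)%Z)%:P], [::] => x y.
  rewrite lin_extend lin_dilate /= !andbT linD linZ linB !linC -/k -/e.
  rewrite Lq -[RHS]subr_ge0 -[RHS](eqv (- e) _ (k %% - e)%Z); last first.
    by rewrite modz_ge0 ?ltz_mod; lia.
  congr (0 <= _); rewrite {1}(divz_eq k (- e)) -/e; ring.
- have /dvdL/dvdzP[q Lq] : e != 0 by rewrite gt_eqF.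
  exists [:: - (q *: (a - (a`_0)%:P) + ((k %/ e)%Z)%:P)], [::], [::] => x y.
  rewrite lin_extend lin_dilate /= !andbT linN linD linZ linB !linC -/k -/e.
  rewrite Lq -[RHS]subr_ge0 -[RHS](eqv e _ (k %% e)%Z); last first.
    by rewrite modz_ge0 ?ltz_mod; lia.
  congr (0 <= _); rewrite {1}(divz_eq k e) -/e; ring.
- exists [::], [::], [:: k%:P + L *: (a - (a`_0)%:P)] => x y.
  by rewrite lin_extend lin_dilate /= -/e e0 mul0r addr0 andbT linD linZ linB !linC.
Qed.

(* Dilating the variables by a common multiple of the pivots makes every
   rounded bound on the last variable an integral form again. *)
Lemma split_bounds n (S : seq {poly int}) :
  exists2 L : int, 0 < L & forall rho, exists ls us cs, forall x y,
    sol n.+1 S (extend n (fun i => L * x i + rho i) y) =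
    [&& all (fun l => lin n l x <= y) ls, all (fun u => y <= lin n u x) us
      & sol n cs x].
Proof.
have [L L0 dvdL] : exists2 L : int, 0 < L &
    forall a, a \in S -> a`_n.+1 != 0 -> (a`_n.+1 %| L)%Z.
  elim: S => [|a S [L L0 IH]]; first by exists 1.
  exists (L * (if a`_n.+1 == 0 then 1 else `|a`_n.+1|)).
    by case: eqP; rewrite ?mulr1// => /eqP; rewrite -normr_gt0; exact: mulr_gt0.
  move=> b; rewrite inE => /predU1P[->|bS] b0; last by rewrite dvdz_mulr ?IH.
  by rewrite (negbTE b0) dvdz_mull// dvdzE -abszE absz_nat dvdnn.
exists L => // rho.
elim: S dvdL => [|a S IHS] dvdL; first by exists [::], [::], [::].
have [b bS|ls [us [cs E]]] := IHS; first by apply: dvdL; rewrite inE bS orbT.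
have [|ls1 [us1 [cs1 E1]]] := @split_bound1 n a L rho.
  by apply: dvdL; rewrite mem_head.
exists (ls1 ++ ls), (us1 ++ us), (cs1 ++ cs) => x y /=.
rewrite E1 E !all_cat.
by do ![case: (all _ _) => //=].
Qed.

(** The bounds on [y] are integral forms, so comparing every lower bound with every upper bound is
    exact over the integers. The modulus [L] does not depend on [rho], so it serves all residue
    classes at once. *)
Lemma int_elim n (S : seq {poly int}) :
  exists2 L : int, 0 < L & forall rho, exists S', forall x,
    sol n S' x <-> exists y, sol n.+1 S (extend n (fun i => L * x i + rho i) y).
Proof.
have [L L0 E] := split_bounds n S; exists L => // rho.
have [ls [us [cs {}E]]] := E rho.
exists ([seq u - l | l <- ls, u <- us] ++ cs) => x.
have -> : sol n ([seq u - l | l <- ls, u <- us] ++ cs) x =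
    allrel <=%R [seq lin n l x | l <- ls] [seq lin n u x | u <- us] && sol n cs x.
  rewrite all_cat; congr (_ && _); apply/allP/allrelP => [H|H].
    move=> _ _ /mapP[l lls ->] /mapP[u uus ->].
    by rewrite -subr_ge0 -linB; apply: H; apply/allpairsP; exists (l, u).
  move=> _ /allpairsP[[l u] /= [lls uus ->]].
  by rewrite linB subr_ge0; apply: H; apply: map_f.
split=> [/andP[/ex_between[y [ly yu]] sx]|[y]].
  by exists y; rewrite E sx; move: ly yu; rewrite !all_map => -> ->.
rewrite E => /and3P[ly yu ->]; rewrite andbT; apply/ex_between; exists y.
by rewrite !all_map.
Qed.

(** * Eventually quasi-polynomial maxima *)

Definition ev (P : int -> Prop) := exists N : int, forall t, N <= t -> P t.

Lemma ev_and P Q : ev P -> ev Q -> ev (fun t => P t /\ Q t).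
Proof.
move=> [N NP] [M MQ]; exists (Num.max N M) => t.
by rewrite ge_max => /andP[/NP ? /MQ].
Qed.

Lemma ev_imp (P Q : int -> Prop) : (forall t, P t -> Q t) -> ev P -> ev Q.
Proof. by move=> PQ [N NP]; exists N => t /NP/PQ. Qed.

Lemma ev_ge N : ev (fun t => N <= t). Proof. by exists N. Qed.

Lemma ev_all (I : eqType) (s : seq I) (P : I -> int -> Prop) :
  (forall i, i \in s -> ev (P i)) -> ev (fun t => forall i, i \in s -> P i t).
Proof.
elim: s => [|a s IHs] H; first by exists 0.
have [||N NP] := @ev_and (P a) (fun t => forall i, i \in s -> P i t).
- by apply: H; rewrite mem_head.
- by apply: IHs => i si; apply: H; rewrite in_cons si orbT.
by exists N => t /NP[Pa Ps] i; rewrite inE => /predU1P[->|/Ps].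
Qed.

Lemma ev_affine (d r : int) P : 0 < d -> ev P -> ev (fun t => P (d * t + r)).
Proof.
by move=> d0 [N NP]; exists (`|N| + `|r|) => t tN; apply: NP; nia.
Qed.

(** Induction in Horner form: once [p.[t]] is at least 1 in absolute value, [p.[t] * t] outgrows the
    constant [c]. *)
Lemma poly_sign (p : {poly int}) :
  [\/ p = 0, ev (fun t => 1 <= p.[t]) | ev (fun t => p.[t] <= -1)].
Proof.
elim/poly_ind: p => [|p c [->|[N pN]|[N pN]]]; first by constructor 1.
- rewrite mul0r add0r; case: (ltgtP c 0) => [c0|c0|->]; last by constructor 1.
    by constructor 3; exists 0 => t _; rewrite hornerC; lia.
  by constructor 2; exists 0 => t _; rewrite hornerC; lia.
- constructor 2; exists (`|N| + `|c| + 1) => t tN.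
  have /pN p1 : N <= t by lia.
  have : `|c| + 1 <= p.[t] * t by apply: le_trans (ler_peMl _ p1); lia.
  by rewrite hornerMXaddC; lia.
- constructor 3; exists (`|N| + `|c| + 1) => t tN.
  have /pN p1 : N <= t by lia.
  have : `|c| + 1 <= - p.[t] * t by apply: le_trans (ler_peMl _ _); lia.
  by rewrite hornerMXaddC; lia.
Qed.

Lemma ev_poly_ge0 (p : {poly int}) :
  ev (fun t => 0 <= p.[t]) \/ ev (fun t => p.[t] < 0).
Proof.
case: (poly_sign p) => [->|[N pN]|[N pN]].
- by left; exists 0 => t _; rewrite horner0.
- by left; exists N => t /pN; lia.
- by right; exists N => t /pN; lia.
Qed.

Lemma ev_poly_le (p q : {poly int}) :
  ev (fun t => p.[t] <= q.[t]) \/ ev (fun t => q.[t] < p.[t]).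
Proof.
case: (ev_poly_ge0 (q - p)) => [] [N H]; [left|right];
  by exists N => t /H; rewrite hornerD hornerN ?subr_ge0 ?subr_lt0.
Qed.

Lemma ev_poly_all (s : seq {poly int}) :
  ev (fun t => forall p, p \in s -> 0 <= p.[t]) \/
  ev (fun t => exists2 p, p \in s & p.[t] < 0).
Proof.
have [H|] := pselect (forall p, p \in s -> ev (fun t => 0 <= p.[t])).
  by left; apply: ev_all.
move=> /existsNP[p /not_implyP[ps pn]]; right.
by case: (ev_poly_ge0 p) => // - [N H]; exists N => t /H; exists p.
Qed.

Lemma ev_poly_min (s : seq {poly int}) : s != [::] ->
  exists2 u, u \in s & ev (fun t => forall v, v \in s -> u.[t] <= v.[t]).
Proof.
elim: s => // a [|b s] IHs _.
  exists a; first exact: mem_head.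
  by exists 0 => t _ v; rewrite inE => /eqP->.
have [//|u us uP] := IHs; case: (ev_poly_le u a) => [ua|au].
  exists u; first by rewrite in_cons us orbT.
  have := ev_and uP ua; apply: ev_imp => t [H1 H2] v.
  by rewrite in_cons => /predU1P[->|/H1].
exists a; first exact: mem_head.
have := ev_and uP au; apply: ev_imp => t [H1 H2] v.
by rewrite in_cons => /predU1P[->//|/H1]; apply: le_trans; exact: ltW.
Qed.

(** [None] stands for the empty set; a nonempty set without upper bound satisfies this for no
    [o]. *)
Definition max_is (X : int -> Prop) (o : option int) : Prop :=
  if o is Some m then X m /\ (forall z, X z -> z <= m) else forall z, ~ X z.

Definition aff_ok (aff : bool) (o : option {poly int}) :=
  oapp (fun p : {poly int} => aff ==> (size p <= 2)%N) true o.

(** The offset [r] ranges over all integers, not only over [[0, d)], so affine changes of parameter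
    compose without reduction modulo [d]. *)
Definition qmax_at (d : int) (aff : bool) (X : int -> int -> Prop) :=
  forall r : int, exists2 o, aff_ok aff o &
    ev (fun t => max_is (X (d * t + r)) (omap (horner^~ t) o)).

(* The maximum of the family X is eventually quasi-polynomial, with integral
   polynomials in the quotient variable of each residue class; the flag aff
   asks for these polynomials to be affine. *)
Definition qmax (aff : bool) (X : int -> int -> Prop) :=
  exists2 d : int, 0 < d & qmax_at d aff X.

Definition aff_poly (d r : int) : {poly int} := d *: 'X + r%:P.

Lemma horner_aff_poly d r t : (aff_poly d r).[t] = d * t + r.
Proof. by rewrite /aff_poly !hornerE. Qed.

Lemma size_aff_poly d r : (size (aff_poly d r) <= 2)%N.
Proof.
rewrite (leq_trans (size_polyD _ _))// geq_max (leq_trans (size_scale_leq _ _)).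
  by rewrite (leq_trans (size_polyC_leq1 _)).
by rewrite size_polyX.
Qed.

Lemma aff_ok_comp aff o d r :
  aff_ok aff o -> aff_ok aff (omap (fun p => p \Po aff_poly d r) o).
Proof.
case: o => //= p; case: aff => //= sp.
rewrite (leq_trans (size_comp_poly_leq _ _))//.
by have := size_aff_poly d r; case: (size _) (size _) sp => [|[|[]]]// [|[|[]]].
Qed.

Lemma omap_horner_comp (o : option {poly int}) d r t :
  omap (horner^~ t) (omap (fun p => p \Po aff_poly d r) o) =
  omap (horner^~ (d * t + r)) o.
Proof. by case: o => //= p; rewrite horner_comp horner_aff_poly. Qed.

Lemma qmax_const aff X o : aff_ok aff o ->
  ev (fun t => max_is (X t) (omap (horner^~ t) o)) -> qmax aff X.
Proof.
move=> ok oX; exists 1 => // r; exists (omap (fun p => p \Po aff_poly 1 r) o).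
  exact: aff_ok_comp.
have := ev_affine r (ltr01 : (0 : int) < 1) oX; apply: ev_imp => t.
by rewrite omap_horner_comp.
Qed.

(** Used to refine a modulus [d] to a multiple [d * e], and so to bring several families to a common
    modulus. *)
Lemma qmax_at_mul aff d e q r X : 0 < e ->
  qmax_at d aff X -> exists2 o, aff_ok aff o &
  ev (fun t => max_is (X (d * (e * t + q) + r)) (omap (horner^~ t) o)).
Proof.
move=> e0 /(_ r)[f ok fX]; exists (omap (fun p => p \Po aff_poly e q) f).
  exact: aff_ok_comp.
have := ev_affine q e0 fX; apply: ev_imp => t.
by rewrite omap_horner_comp.
Qed.

(** Only the maxima have to correspond under [z] to [L * z + q.[t]]; the sets themselves need
    not. *)
Lemma qmax_affine aff L (q : {poly int}) X Y : (aff ==> (size q <= 2)%N) ->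
  ev (fun t => forall o, max_is (X t) o ->
     max_is (Y t) (omap (fun z => L * z + q.[t]) o)) ->
  qmax aff X -> qmax aff Y.
Proof.
move=> sq XY [d d0 dX]; exists d => // r; have [f ok fX] := dX r.
exists (omap (fun p => L *: p + (q \Po aff_poly d r)) f).
  have := @aff_ok_comp aff (Some q) d r sq.
  case: f ok {fX} => //= p; case: aff {sq dX} => //= sp sq.
  rewrite (leq_trans (size_polyD _ _))// geq_max sq andbT.
  by rewrite (leq_trans (size_scale_leq _ _)).
have := ev_and fX (ev_affine r d0 XY); apply: ev_imp => t [H /(_ _ H)].
case: f {ok fX H} => //= p.
by rewrite hornerD hornerZ horner_comp horner_aff_poly.
Qed.

Lemma qmax_ext aff X Y : ev (fun t => forall z, X t z <-> Y t z) ->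
  qmax aff X -> qmax aff Y.
Proof.
move=> XY; apply: (@qmax_affine _ 1 0); first by rewrite size_poly0 implybT.
move: XY; apply: ev_imp => t XY [m|] /=; last by move=> + z /XY; apply.
move=> [/XY Ym mX]; rewrite mul1r horner0 addr0; split=> // z /XY; exact: mX.
Qed.

(** On each class of a common modulus the two polynomial maxima are eventually ordered, and the
    larger one is kept. *)
Lemma qmax_or aff X Y : qmax aff X -> qmax aff Y ->
  qmax aff (fun t z => X t z \/ Y t z).
Proof.
move=> [d d0 dX] [e e0 eY]; exists (d * e) => [|r]; first exact: mulr_gt0.
have [f1 ok1 H1] := qmax_at_mul 0 r e0 dX.
have [f2 ok2 H2] := qmax_at_mul 0 r d0 eY.
have {}H1 : ev (fun t => max_is (X (d * e * t + r)) (omap (horner^~ t) f1)).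
  by move: H1; apply: ev_imp => t; rewrite addr0 mulrA.
have {}H2 : ev (fun t => max_is (Y (d * e * t + r)) (omap (horner^~ t) f2)).
  by move: H2; apply: ev_imp => t; rewrite addr0 mulrA (mulrC e).
have H := ev_and H1 H2.
case: f1 f2 ok1 ok2 H {H1 H2} => [p|] [q|] /= okp okq H.
- case: (ev_poly_le p q) => /(ev_and H){}H.
    exists (Some q) => //; move: H; apply: ev_imp => t [[[_ Xp] [Yq mq]] pq].
    by split=> [|z [/Xp zp|/mq//]]; [right|exact: le_trans zp pq].
  exists (Some p) => //; move: H; apply: ev_imp => t [[[Xp mp] [_ Yq]] /ltW qp].
  by split=> [|z [/mp//|/Yq zp]]; [left|exact: le_trans zp qp].
- exists (Some p) => //; move: H; apply: ev_imp => t [[Xp mp] Yn].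
  by split=> [|z [/mp//|/Yn]]; [left|].
- exists (Some q) => //; move: H; apply: ev_imp => t [Xn [Yq mq]].
  by split=> [|z [/Xn//|/mq]]; [right|].
- exists None => //; move: H; apply: ev_imp => t [Xn Yn] z [/Xn|/Yn]//.
Qed.

Lemma qmax_big aff (I : eqType) (s : seq I) (X : I -> int -> int -> Prop) :
  (forall i, qmax aff (X i)) ->
  qmax aff (fun t z => exists2 i, i \in s & X i t z).
Proof.
move=> H; elim: s => [|a s IHs].
  by apply: (@qmax_const _ _ None) => //; exists 0 => t _ z [].
apply: qmax_ext (qmax_or (H a) IHs); exists 0 => t _ z; split.
  move=> [Xa|[i si Xi]]; first by exists a; rewrite ?mem_head.
  by exists i; rewrite // in_cons si orbT.
by move=> [i]; rewrite in_cons => /predU1P[->|si] Xi; [left|right; exists i].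
Qed.

Lemma qmax_reparam aff L X : 0 < L ->
  (forall r, qmax aff (fun t => X (L * t + r))) -> qmax aff X.
Proof.
case: L => [[|M]|]// _ H.
have {}H (r : int) : {d : int | 0 < d /\ qmax_at d aff (fun t => X (M.+1%:Z * t + r))}.
  by apply: cid; have [d ? ?] := H r; exists d.
(* Each class modulo [M.+1] comes with its own modulus for the quotient; their product suits all of
   them. *)
pose D := \prod_(i < M.+1) sval (H i%:Z).
have D0 : 0 < D by apply: prodr_gt0 => i _; case: (H i%:Z) => d [].
exists (M.+1%:Z * D) => [|r]; first exact: mulr_gt0.
have rM : (`|(r %% M.+1)%Z| < M.+1)%N.
  by have := ltz_pmod r (isT : 0 < M.+1%:Z); have := modz_ge0 r (isT : M.+1%:Z != 0); lia.
set i := Ordinal rM; have ri : r = (r %/ M.+1)%Z * M.+1 + i%:Z.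
  by rewrite {1}(divz_eq r M.+1) /i /= gez0_abs ?modz_ge0.
have [d0 dX] := svalP (H i%:Z).
have De : D = sval (H i%:Z) * \prod_(j < M.+1 | j != i) sval (H j%:Z).
  by rewrite /D (bigD1 i).
have e0 : 0 < \prod_(j < M.+1 | j != i) sval (H j%:Z).
  by apply: prodr_gt0 => j _; case: (H j%:Z) => d [].
have [f ok fX] := qmax_at_mul 0 (r %/ M.+1)%Z e0 dX.
exists f => //; move: fX; apply: ev_imp => t.
rewrite addr0 mulrA -De; congr (max_is (X _) _).
by rewrite [in RHS]ri; ring.
Qed.

(** One upper bound [u] is eventually the least. It is the maximum if it passes all lower bounds and
    the side conditions hold; otherwise the interval is empty. Each of these signs is eventually
    constant. *)
Lemma qmax_interval (ls us cs : seq {poly int}) (X : int -> int -> Prop) :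
  all (fun u : {poly int} => size u <= 2)%N us ->
  (forall t z, X t z <-> [/\ forall l, l \in ls -> l.[t] <= z,
     forall u, u \in us -> z <= u.[t] & forall c, c \in cs -> 0 <= c.[t]]) ->
  ev (fun t => exists B, forall z, X t z -> z <= B) -> qmax true X.
Proof.
move=> /allP us2 XE bX.
have [us0|/ev_poly_min[u uus umin]] := eqVneq us [::].
  (* Without upper bounds, any point could be raised to [B + 1], beyond the bound [B]; so there is
     no point. *)
  apply: (@qmax_const _ _ None) => //; move: bX; apply: ev_imp => t [B XB] z.
  move=> Xz; have := XB (Num.max z (B + 1)).
  suff: X t (Num.max z (B + 1)) by move=> /[swap]/[apply]; lia.
  move: Xz; rewrite !XE us0 => -[lz _ cz]; split=> // l /lz lez.
  by rewrite le_max lez.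
case: (ev_poly_all ([seq u - l | l <- ls] ++ cs)) => [all0|ex0].
  apply: (@qmax_const _ _ (Some u)); first exact: us2.
  have := ev_and umin all0; apply: ev_imp => t [uP H]; split; last first.
    by move=> z /XE[_ + _]; apply.
  apply/XE; split=> // [l lls|c ccs]; last by apply: H; rewrite mem_cat ccs orbT.
  rewrite -subr_ge0 -hornerN -hornerD H// mem_cat.
  by apply/orP; left; apply/mapP; exists l.
apply: (@qmax_const _ _ None) => //; move: ex0; apply: ev_imp => t [p].
rewrite mem_cat => /orP[/mapP[l lls ->]|pcs] p0 z /XE[Hl Hu Hc].
  move: p0; rewrite hornerD hornerN subr_lt0 ltNge.
  by rewrite (le_trans (Hl _ lls) (Hu _ uus)).
by move: p0; rewrite ltNge Hc.
Qed.

(** Variable 0 is the parameter, variable 1 the quantity to maximise, and [k] further integer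
    variables are projected out. *)
Definition coord_family k (S : seq {poly int}) (t z : int) :=
  exists x : nat -> int, [/\ x 0%N = t, x 1%N = z & sol k.+2 S x].

Lemma eq_sol_lin (K : numDomainType) n (S : seq {poly K}) x y :
  (forall i, (i < n)%N -> x i = y i) -> sol n S x = sol n S y.
Proof. by move=> xy; apply: eq_all => a; rewrite (eq_lin _ xy). Qed.

Lemma qmax_coord_family0 S :
  ev (fun t => exists B, forall z, coord_family 0 S t z -> z <= B) ->
  qmax true (coord_family 0 S).
Proof.
move=> bS; have [L L0 H] := split_bounds 1 S.
apply: (qmax_reparam L0) => r; have [ls [us [cs E]]] := H (fun=> r).
pose g (l : {poly int}) := aff_poly l`_1 l`_0.
have gE l t : (g l).[t] = lin 1 l (fun=> t).
  by rewrite horner_aff_poly /lin big_ord1 addrC.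
apply: (@qmax_interval (map g ls) (map g us) (map g cs)).
- by rewrite all_map; apply/allP => u _; exact: size_aff_poly.
- move=> t z; have -> : coord_family 0 S (L * t + r) z <->
      sol 2 S (extend 1 (fun=> L * t + r) z).
    split=> [[x [x0 x1]]|Sx]; last by exists (extend 1 (fun=> L * t + r) z).
    by congr is_true; apply: eq_sol_lin => -[|[]].
  rewrite (E (fun=> t)); split=> [/and3P[/allP ll /allP uu /allP cc]|[ll uu cc]].
    by split=> _ /mapP[p ps ->]; rewrite gE; [exact: ll|exact: uu|exact: cc].
  by apply/and3P; split; apply/allP => p ps; rewrite -gE;
    [apply: ll|apply: uu|apply: cc]; exact: map_f.
- exact: (ev_affine r L0 bS).
Qed.

(** Induction on [k]. Eliminating the last variable requires the residues modulo [L] of all the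
    others: that of [t] is fixed by [qmax_reparam], the rest by a finite union over residue vectors
    [f]. On each piece the value is [L * z' + rho f 1]. *)
Lemma qmax_coord_family k S :
  ev (fun t => exists B, forall z, coord_family k S t z -> z <= B) ->
  qmax true (coord_family k S).
Proof.
elim: k S => [|k IHk] S bS; first exact: qmax_coord_family0.
have [[[|M]|]// L0 H] := int_elim k.+2 S.
apply: (qmax_reparam L0) => r; set L := Posz M.+1 in L0 H *.
pose rho (f : {ffun 'I_k.+1 -> 'I_M.+1}) (i : nat) : int :=
  if i is j.+1 then (f (inord j) : nat)%:Z else r.
have {}H f : {S' | forall x, sol k.+2 S' x <->
   exists y, sol k.+3 S (extend k.+2 (fun i => L * x i + rho f i) y)}.
  by apply: cid; exact: H.
have famE t z : coord_family k.+1 S (L * t + r) z <->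
    exists2 f, f \in enum {ffun 'I_k.+1 -> 'I_M.+1} &
    exists2 z', coord_family k (sval (H f)) t z' & z = L * z' + rho f 1%N.
  split=> [[x [x0 x1 Sx]]|[f _ [z' [x [x0 x1 /(svalP (H f))[y Sy]]] ->]]].
    exists [ffun j : 'I_k.+1 => inord `|(x j.+1 %% L)%Z|]; first by rewrite mem_enum.
    set f := finfun _.
    have xE i : (i < k.+2)%N ->
        x i = L * (if i is j.+1 then (x i %/ L)%Z else t) + rho f i.
      case: i => [//|i] lti; rewrite {1}(divz_eq (x i.+1) L) mulrC /rho ffunE.
      have ltx : (`|(x i.+1 %% L)%Z| < M.+1)%N.
        have := ltz_pmod (x i.+1) L0; have := @modz_ge0 (x i.+1) L isT.
        by rewrite /L; lia.
      by rewrite !inordK// gez0_abs ?modz_ge0.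
    exists (x 1%N %/ L)%Z; last by rewrite -x1 {1}(xE 1%N).
    exists (fun i => if i is j.+1 then (x i %/ L)%Z else t); split=> //.
    apply/(svalP (H f)); exists (x k.+2).
    rewrite -(@eq_sol_lin _ _ _ x)// => i lti; rewrite /extend.
    case: ltnP => [/xE //|lei]; have -> // : i = k.+2 by lia.
  exists (extend k.+2 (fun i => L * x i + rho f i) y); split=> //.
    by rewrite /extend /= x0.
  by rewrite /extend /= x1.
apply: (@qmax_ext _ (fun t z => exists2 f, f \in enum {ffun 'I_k.+1 -> 'I_M.+1} &
    exists2 z', coord_family k (sval (H f)) t z' & z = L * z' + rho f 1%N)).
  by exists 0 => t _ z; rewrite famE.
apply: qmax_big => f.
apply: (@qmax_affine _ L (rho f 1%N)%:P (coord_family k (sval (H f)))).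
- by rewrite (leq_trans (size_polyC_leq1 _)).
- exists 0 => t _ [m|] /=; rewrite ?hornerC; last first.
    by move=> + z [z' /[swap] _]; apply.
  by move=> [Xm mX]; split; [exists m|move=> z [z' /mX zm ->]; rewrite /L; nia].
(* Since [L >= 1], a bound on [L * z + rho f 1] also bounds [z]. *)
apply: IHk; have := ev_affine r L0 bS; apply: ev_imp => t [B bB].
exists (`|B| + `|rho f 1%N|) => z fz.
have /bB : coord_family k.+1 S (L * t + r) (L * z + rho f 1%N).
  by apply/famE; exists f; [rewrite mem_enum|exists z].
by rewrite /L; nia.
Qed.

(** * Expansion in base t *)

(* Most significant digit first. *)
Definition digit_value (w : int) D (y : nat -> int) : int :=
  \sum_(j < D.+1) w ^+ (D - j) * y j.

Lemma digit_value0 w y : digit_value w 0 y = y 0%N.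
Proof. by rewrite /digit_value big_ord1 mul1r. Qed.

Lemma digit_valueS w D y :
  digit_value w D.+1 y = w ^+ D.+1 * y 0%N + digit_value w D (fun j => y j.+1).
Proof. by rewrite /digit_value big_ord_recl subn0. Qed.

Lemma eq_digit_value w D y y' : (forall j, (j < D.+1)%N -> y j = y' j) ->
  digit_value w D y = digit_value w D y'.
Proof. by move=> E; apply: eq_bigr => j _; rewrite E. Qed.

Lemma digit_value_bound w D y : (forall j, (j < D.+1)%N -> 0 <= y j < w) ->
  0 <= digit_value w D y < w ^+ D.+1.
Proof.
elim: D y => [|D IHD] y yw; first by rewrite digit_value0 yw.
rewrite digit_valueS; have /andP[] := IHD (fun j => y j.+1) (fun j => yw j.+1).
have /andP[y0 yw0] := yw 0%N isT; have w0 := le_lt_trans y0 yw0.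
have W0 : 0 < w ^+ D.+1 by rewrite exprn_gt0.
rewrite [w ^+ D.+2]exprS; move: (w ^+ D.+1) W0 => W W0 v0 vW; nia.
Qed.

Lemma digit_expansion w D x : 0 < w -> 0 <= x < w ^+ D.+1 ->
  exists2 y, forall j, (j < D.+1)%N -> 0 <= y j < w & x = digit_value w D y.
Proof.
move=> w0; elim: D x => [|D IHD] x /andP[x0 xw].
  by exists (fun=> x); [move=> j _; rewrite x0|rewrite digit_value0].
set W := w ^+ D.+1; have W0 : 0 < W by rewrite exprn_gt0.
have [|y yw yE] := IHD (x %% W)%Z; first by rewrite modz_ge0 ?ltz_pmod// gt_eqF.
exists (fun j => if j is j'.+1 then y j' else (x %/ W)%Z) => [[_|j]|]; last first.
- by rewrite digit_valueS -yE mulrC -divz_eq.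
- by rewrite ltnS => /yw.
- rewrite divz_ge0// x0 -(ltr_pM2r W0).
  rewrite (le_lt_trans _ (xw : x < w * W))//.
  by rewrite {2}(divz_eq x W) lerDl modz_ge0// gt_eqF.
Qed.

(** The base is a polynomial in the parameter because replacing [t] by [d * t + r] has to leave the
    actual base unchanged. *)
Definition digit_family D n (w : {poly int}) (S : seq {poly int}) (t z : int) :=
  exists x : nat -> int,
    [/\ x 0%N = t, z = digit_value w.[t] D (fun j => x j.+1) & sol n S x].

Lemma qmax_weaken X : qmax true X -> qmax false X.
Proof.
move=> [d d0 H]; exists d => // r; have [f _ fX] := H r.
by exists f => //; case: (f).
Qed.

Lemma lin_aff_poly n d r (x : nat -> int) :
  lin n.+1 (aff_poly d r) x = d * x 0%N + r.
Proof. by rewrite linD linZ linC -['X]expr1 linX. Qed.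

Lemma horner_size2 (p : {poly int}) t : (size p <= 2)%N -> p.[t] = p`_1 * t + p`_0.
Proof.
move=> sp; rewrite (horner_coef_wide _ sp) !big_ord_recl big_ord0 addr0.
by rewrite mulr1 mulrC addrC mulrC.
Qed.

Lemma sol_subst m n (f : nat -> {poly int}) S x :
  sol m (map (subst_form n f) S) x = sol n S (fun i => lin m (f i) x).
Proof. by rewrite all_map; apply: eq_all => a /=; rewrite lin_subst. Qed.

(* The maximal value has the largest possible leading digit, which is
   quasi-affine in t; substituting it removes one variable. *)
Lemma qmax_digit_family D n w S : (D.+1 < n)%N ->
  (exists T, forall x, T <= x 0%N -> sol n S x ->
     forall j, (j < D.+1)%N -> 0 <= x j.+1 < w.[x 0%N]) ->
  qmax false (digit_family D n w S).
Proof.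
elim: D n w S => [|D IHD] [//|n] w S + [T HT].
  case: n HT => [//|k] HT _; apply/qmax_weaken.
  apply: (@qmax_ext _ (coord_family k S)).
    exists 0 => t _ z; split=> [[x [x0 x1 Sx]]|[x [x0 -> Sx]]].
      by exists x; split=> //; rewrite digit_value0.
    by exists x; split=> //; rewrite digit_value0.
  apply: qmax_coord_family; exists T => t tT; exists w.[t] => z [x [x0 <- Sx]].
  have := HT x; rewrite x0 => /(_ tT Sx 0%N isT) /andP[_]; exact: ltW.
case: n HT => [//|[//|k]] HT; rewrite !ltnS => lek.
have [|d d0 H] := @qmax_coord_family k.+1 S.
  exists T => t tT; exists w.[t] => z [x [x0 <- Sx]].
  have := HT x; rewrite x0 => /(_ tT Sx 0%N isT) /andP[_]; exact: ltW.
apply: (qmax_reparam d0) => r; have [[p|] /= sp pmax] := H r; last first.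
  apply: (@qmax_const _ _ None) => //; move: pmax; apply: ev_imp => t Xn z.
  by move=> [x [x0 _ Sx]]; apply: (Xn (x 1%N)); exists x.
(* The parameter becomes [d * t + r], the leading digit becomes [p], and the later variables move
   down by one. Since [p] is affine, the result is again a system of forms with constant
   coefficients. *)
pose f i : {poly int} := if i is i'.+1 then if i' is j.+1 then 'X^(j.+2)
  else aff_poly p`_1 p`_0 else aff_poly d r.
pose w' := w \Po aff_poly d r.
pose S' := map (subst_form k.+3 f) S.
have fE x x' t : x 0%N = d * t + r -> x 1%N = p.[t] -> x' 0%N = t ->
    (forall j, x j.+2 = x' j.+1) -> sol k.+2 S' x' = sol k.+3 S x.
  move=> x0 x1 x'0 xx'; rewrite sol_subst; apply: (@eq_sol_lin _) => -[|[|j]] lj /=.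
  - by rewrite lin_aff_poly x'0 x0.
  - by rewrite lin_aff_poly x'0 x1 horner_size2.
  - by rewrite linX.
have tT : ev (fun t => T <= d * t + r) := ev_affine r d0 (ev_ge T).
pose x_of t (x' : nat -> int) i :=
  if i is i'.+1 then if i' is j.+1 then x' j.+1 else p.[t] else d * t + r.
have IH : qmax false (digit_family D k.+2 w' S').
  apply: IHD => //; have [T' HT'] := tT; exists T' => x' x'T Sx' j lj.
  have Sx : sol k.+3 S (x_of (x' 0%N) x') by rewrite -(fE _ x' (x' 0%N)).
  have := HT (x_of (x' 0%N) x') (HT' _ x'T) Sx j.+1 lj.
  by rewrite /w' horner_comp horner_aff_poly.
apply: (@qmax_affine false 1 (w' ^+ D.+1 * p) _ _ isT _ IH).
have := ev_and pmax tT; apply: ev_imp => t [[[xm [xm0 xm1 Sm]] mX] {}tT].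
have wE : w'.[t] = w.[d * t + r] by rewrite /w' horner_comp horner_aff_poly.
move=> [m|] /=; rewrite ?hornerM ?horner_exp ?wE; last first.
  (* A point attaining the maximal leading digit yields a member of the reduced family, which
     therefore is not empty. *)
  move=> H'; exfalso.
  pose x' i := if i is j.+1 then xm j.+2 else t.
  apply: (H' (digit_value w'.[t] D (fun j => x' j.+1))); exists x'; split=> //.
  by rewrite (fE xm x' t).
move=> [[x' [x'0 mE Sx']] x'm]; split.
  exists (x_of t x'); split=> //; last by rewrite -(fE _ x' t).
  by rewrite digit_valueS mul1r mE wE addrC.
move=> z [x [x0 -> Sx]].
have := HT x; rewrite x0 => /(_ tT Sx) xb.
have /mX : coord_family k.+1 S (d * t + r) (x 1%N) by exists x.
(* With equal leading digits the lower digits decide. A smaller leading digit loses at least the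
   base to the power [D.+1], more than the lower digits can regain. *)
rewrite le_eqVlt => /predU1P[x1|x1].
  pose y i := if i is j.+1 then x j.+2 else t.
  rewrite digit_valueS x1 mul1r addrC lerD2r -wE; apply: x'm.
  by exists y; split=> //; rewrite (fE x y t).
have Sxx' : sol k.+3 S (x_of t x') by rewrite -(fE _ x' t).
have := HT (x_of t x') tT Sxx' => xb'.
have m0 : 0 <= m.
  have yb j : (j < D.+1)%N -> 0 <= x' j.+1 < w'.[t].
    by move=> lj; have := xb' j.+1 lj; rewrite /= wE.
  by rewrite mE; case/andP: (digit_value_bound yb).
have /andP[_] := @digit_value_bound w.[d * t + r] D (fun j => x j.+2) (fun j => xb j.+1).
rewrite digit_valueS.
have /andP[a0 a1] := xb 0%N isT; have W0 := le_lt_trans a0 a1.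
have {W0} W0 : 0 < w.[d * t + r] ^+ D.+1 by rewrite exprn_gt0.
move: (w.[d * t + r] ^+ D.+1) W0 x1 => W W0.
move: (p.[t]) (x 1%N) (digit_value _ _ _) => a b v; nia.
Qed.

(** * Finite disjunctions of systems of inequalities *)

Section Definable.
Variables (A : eqType) (T : Type) (sat : A -> T -> bool).

Definition dnf (F : seq (seq A)) x := has (fun c => all (sat^~ x) c) F.

(** The equivalence is asked on [B] only: the carries are bounded only for digits in their proper
    range. *)
Definition definable (B X : T -> Prop) :=
  exists F, forall x, B x -> (X x <-> dnf F x).

Lemma definable_atom B a : definable B (fun x => sat a x).
Proof. by exists [:: [:: a]] => x _; rewrite /dnf /= andbT orbF. Qed.

Lemma definable_ext B (X Y : T -> Prop) : (forall x, B x -> (X x <-> Y x)) ->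
  definable B X -> definable B Y.
Proof.
move=> XY [F FX]; exists F => x Bx.
by split=> [/(XY _ Bx)/(FX _ Bx)|/(FX _ Bx)/(XY _ Bx)].
Qed.

Lemma definable_or B X Y : definable B X -> definable B Y ->
  definable B (fun x => X x \/ Y x).
Proof.
move=> [F FX] [G GY]; exists (F ++ G) => x Bx; rewrite /dnf has_cat.
split=> [[/(FX _ Bx)|/(GY _ Bx)]|/orP[/(FX _ Bx)|/(GY _ Bx)]].
- by rewrite /dnf => ->.
- by rewrite /dnf orbC => ->.
- by left.
- by right.
Qed.

Lemma definable_and B X Y : definable B X -> definable B Y ->
  definable B (fun x => X x /\ Y x).
Proof.
move=> [F FX] [G GY]; exists [seq c ++ c' | c <- F, c' <- G] => x Bx.
split=> [[/(FX _ Bx)/hasP[c cF cx] /(GY _ Bx)/hasP[c' cG c'x]]|].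
  apply/hasP; exists (c ++ c'); last by rewrite all_cat cx.
  by apply/allpairsP; exists (c, c').
move=> /hasP[_ /allpairsP[[c c'] /= [cF cG ->]]]; rewrite all_cat => /andP[cx c'x].
by split; [apply/(FX _ Bx)|apply/(GY _ Bx)]; apply/hasP; [exists c|exists c'].
Qed.

Lemma definable_ex (I : eqType) (s : seq I) B (X : I -> T -> Prop) :
  (forall i, definable B (X i)) ->
  definable B (fun x => exists2 i, i \in s & X i x).
Proof.
move=> H; elim: s => [|a s IHs].
  by exists [::] => x _; split=> [[]|].
apply: definable_ext (definable_or (H a) IHs) => x _; split.
  move=> [Xa|[i si Xi]]; first by exists a; rewrite ?mem_head.
  by exists i; rewrite // in_cons si orbT.
by move=> [i]; rewrite in_cons => /predU1P[->|si] Xi; [left|right; exists i].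
Qed.

Lemma definable_all (I : eqType) (s : seq I) B (X : I -> T -> Prop) :
  (forall i, definable B (X i)) ->
  definable B (fun x => forall i, i \in s -> X i x).
Proof.
move=> H; elim: s => [|a s IHs].
  by exists [:: [::]] => x _.
apply: definable_ext (definable_and (H a) IHs) => x _; split.
  by move=> [Xa Xs] i; rewrite in_cons => /predU1P[->|/Xs].
by move=> Xs; split=> [|i si]; apply: Xs; rewrite ?mem_head// in_cons si orbT.
Qed.

End Definable.

(* Variable 0 is the parameter t, the other ones are digits in base t. *)
Definition digit_box n (x : nat -> int) :=
  1 <= x 0%N /\ forall i, (i < n)%N -> 0 <= x i.+1 < x 0%N.

Definition form_sat n (a : {poly int}) (x : nat -> int) := 0 <= lin n a x.

(** A polynomial in the parameter [x 0] whose coefficients, lowest degree first, are affine forms in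
    the variables. *)
Definition horner_value n (qs : seq {poly int}) (x : nat -> int) : int :=
  foldr (fun q v => lin n q x + x 0%N * v) 0 qs.

Lemma lin_bound n (q : {poly int}) : exists2 C : int, 0 <= C &
  forall x, digit_box n x -> `|lin n.+1 q x| <= C * x 0%N.
Proof.
exists (`|q`_0| + \sum_(i < n.+1) `|q`_i.+1|).
  by rewrite addr_ge0// sumr_ge0.
move=> x [x0 xb]; rewrite mulrDl (le_trans (ler_normD _ _))// lerD//.
  by rewrite ler_peMr.
rewrite (le_trans (ler_norm_sum _ _ _))// mulr_suml ler_sum// => i _.
rewrite normrM ler_wpM2l//; case: i => [[|i] lti] /=.
  by rewrite ger0_norm// (le_trans _ x0).
by have /andP[xi0 /ltW xi] := xb i lti; rewrite ger0_norm.
Qed.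

Lemma eq_divz_bounds (v t c : int) : 0 < t ->
  (c * t <= v < c * t + t) = (c == (v %/ t)%Z).
Proof.
move=> t0; have := ltz_pmod v t0; have := modz_ge0 v (lt0r_neq0 t0).
have := divz_eq v t; move: (v %% t)%Z (v %/ t)%Z => a b vE a0 alt.
apply/idP/eqP => [/andP[h1 h2]|->]; last by apply/andP; lia.
have : c * t < (b + 1) * t by rewrite mulrDl mul1r; lia.
have : b * t < (c + 1) * t by rewrite mulrDl mul1r; lia.
rewrite !ltr_pM2r//; lia.
Qed.

Lemma divz_norm_le (v t C : int) : 0 < t -> `|v| <= C * t -> `|(v %/ t)%Z| <= C.
Proof.
move=> t0; have := eq_divz_bounds v (v %/ t)%Z t0; rewrite eqxx.
move: (v %/ t)%Z => b /andP[h1 h2] vC.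
have : b * t < (C + 1) * t by rewrite mulrDl mul1r; lia.
have : - C * t < (b + 1) * t by rewrite mulNr mulrDl mul1r; lia.
rewrite !ltr_pM2r//; lia.
Qed.

(* Only boundedly many carries floor(q/t) occur on the digit box. *)
Lemma definable_horner_value n qs (k : int) :
  definable (form_sat n.+1) (digit_box n) (fun x => 0 <= k + horner_value n.+1 qs x).
Proof.
elim: qs k => [|q qs IHqs] k.
  have := definable_atom (form_sat n.+1) (digit_box n) k%:P.
  by apply: definable_ext => x _; rewrite /form_sat linC addr0.
have [C C0 qC] := lin_bound n (k%:P + q).
pose ks := [seq i%:Z - C | i <- iota 0 `|2 * C|.+1].
(* The first two conditions say that [c] is the floor of [k + q] divided by [t]; as [c] is a
   constant, they are affine in the variables. The third passes the carry to the next
   coefficient. *)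
pose X (c : int) x := [/\ form_sat n.+1 (k%:P + q - c *: 'X) x,
  form_sat n.+1 (c *: 'X + 'X - 1%:P - (k%:P + q)) x & 0 <= c + horner_value n.+1 qs x].
have XE c x : X c x <-> c * x 0%N <= k + lin n.+1 q x < c * x 0%N + x 0%N /\
    0 <= c + horner_value n.+1 qs x.
  have aux (a b v : int) : (a <= b < a + v) = (0 <= b - a) && (0 <= a + v - 1 - b).
    by lia.
  rewrite aux /X /form_sat !(linB, linD, linZ, linC) -['X]expr1 linX//.
  by split=> [[-> -> ->]|[/andP[-> ->] ->]].
apply: (@definable_ext _ _ _ _ (fun x => exists2 c, c \in ks & X c x)).
  move=> x Bx; have := qC x Bx; have [x0 _] := Bx; rewrite linD linC => lC.
  rewrite /= addrA; move: (k + lin n.+1 q x) (XE^~ x) lC => v {}XE lC.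
  have t0 : 0 < x 0%N by lia.
  (* The remainder of [v] modulo [t] lies in [[0, t)] and cannot change the sign of a multiple of
     [t]. *)
  have -> : (0 <= v + x 0%N * horner_value n.+1 qs x) =
      (0 <= (v %/ x 0%N)%Z + horner_value n.+1 qs x).
    have := eq_divz_bounds v (v %/ x 0%N)%Z t0; rewrite eqxx.
    by move: (v %/ x 0%N)%Z (horner_value _ _ _) (x 0%N) => b h t; nia.
  split=> [[c _ /XE[]]|vk]; first by rewrite eq_divz_bounds// => /eqP->.
  exists (v %/ x 0%N)%Z; last by apply/XE; rewrite eq_divz_bounds.
  have := divz_norm_le t0 lC; move: (v %/ x 0%N)%Z => b bC.
  by apply/mapP; exists (absz (b + C)); rewrite ?mem_iota; lia.
apply: definable_ex => c.
apply: definable_ext (definable_and (definable_and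
  (definable_atom _ _ (k%:P + q - c *: 'X))
  (definable_atom _ _ (c *: 'X + 'X - 1%:P - (k%:P + q)))) (IHqs c)) => x _.
by split=> [[[]]|[]].
Qed.

Definition represented n (g : (nat -> int) -> int) :=
  exists qs, forall x, g x = horner_value n qs x.

Lemma represented_ext n g h : (forall x, g x = h x) ->
  represented n g -> represented n h.
Proof. by move=> gh [qs E]; exists qs => x; rewrite -gh. Qed.

Lemma represented_lin n q : represented n (lin n q).
Proof. by exists [:: q] => x /=; rewrite mulr0 addr0. Qed.

Lemma represented_add n g h : represented n g -> represented n h ->
  represented n (fun x => g x + h x).
Proof.
move=> [qs gE] [rs hE].
suff [ss sE] : exists ss, forall x,
    horner_value n qs x + horner_value n rs x = horner_value n ss x.
  by exists ss => x; rewrite gE hE.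
elim: qs rs {gE hE} => [|q qs IHq] [|r rs].
- by exists [::] => x; rewrite addr0.
- by exists (r :: rs) => x; rewrite add0r.
- by exists (q :: qs) => x; rewrite addr0.
have [ss sE] := IHq rs; exists (q + r :: ss) => x /=; rewrite linD -sE; ring.
Qed.

Lemma represented_sum n I (r : seq I) g : (forall i, represented n (g i)) ->
  represented n (fun x => \sum_(i <- r) g i x).
Proof.
move=> H; elim: r => [|a r IHr]; first by exists [::] => x; rewrite big_nil.
apply: represented_ext (represented_add (H a) IHr) => x; by rewrite big_cons.
Qed.

Lemma represented_mulX n g : (0 < n)%N ->
  represented n g -> represented n (fun x => x 0%N * g x).
Proof.
move=> n0 [qs gE]; exists (0%:P :: qs) => x /=; by rewrite linC add0r gE.
Qed.

Lemma represented_scale n c g : represented n g -> represented n (fun x => c * g x).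
Proof.
move=> [qs gE]; exists (map (fun q => c *: q) qs) => x; rewrite gE.
by elim: qs {gE} => [|q qs IHq] /=; rewrite ?mulr0// linZ -IHq; ring.
Qed.

Lemma represented_poly n (p : {poly int}) g : (0 < n)%N ->
  represented n g -> represented n (fun x => p.[x 0%N] * g x).
Proof.
move=> n0 gr; elim/poly_ind: p => [|p c IHp].
  by apply: represented_ext (represented_scale 0 gr) => x; rewrite horner0.
apply: represented_ext (represented_add (represented_mulX n0 IHp)
  (represented_scale c gr)) => x.
rewrite hornerMXaddC; ring.
Qed.

(** * Systems over Z[t] rewritten in base-t digits *)

Definition at_param (t : int) (p : {poly {poly int}}) : {poly int} :=
  map_poly (horner_eval t) p.

Definition pform_sat n (p : {poly {poly int}}) (u : int * (nat -> int)) :=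
  0 <= lin n (at_param u.1 p) u.2.

Lemma lin_at_param n t p x :
  lin n (at_param t p) x = (p`_0).[t] + \sum_(i < n) (p`_i.+1).[t] * x i.
Proof.
rewrite /lin coef_map /=; congr (_ + _).
by apply: eq_bigr => i _; rewrite coef_map.
Qed.

(** The digits of coordinate [i] form the [i]-th block of length [D.+1]; the outer successor skips
    the parameter in position 0. *)
Definition undigit D (y : nat -> int) (i : nat) : int :=
  digit_value (y 0%N) D (fun j => y (i * D.+1 + j).+1).

(** Substituting the digit expansions gives a polynomial in [t] with coefficients affine in the
    digits, to which the branching on carries applies. *)
Lemma definable_undigit n D p :
  definable (form_sat (n * D.+1).+1) (digit_box (n * D.+1))
    (fun y => pform_sat n p (y 0%N, undigit D y)).
Proof.
set m := (n * D.+1)%N.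
have [qs qsE] : represented m.+1 (fun y => lin n (at_param (y 0%N) p) (undigit D y)).
  apply: (@represented_ext _ (fun y => (p`_0).[y 0%N] * lin m.+1 1%:P y +
    \sum_(i <- index_enum 'I_n) (p`_i.+1).[y 0%N] *
      \sum_(j <- index_enum 'I_D.+1) ('X^(D - j)).[y 0%N] *
         lin m.+1 'X^((i * D.+1 + j).+2) y)).
    move=> y; rewrite lin_at_param linC mulr1; congr (_ + _).
    apply: eq_bigr => i _; congr (_ * _); apply: eq_bigr => j _.
    rewrite hornerXn linX// ltnS /m.
    by have := ltn_ord i; have := ltn_ord j; nia.
  apply: represented_add; first exact/represented_poly/represented_lin.
  apply: represented_sum => i; apply: represented_poly => //.
  apply: represented_sum => j; exact/represented_poly/represented_lin.
apply: definable_ext (definable_horner_value m qs 0) => y _.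
by rewrite add0r -qsE.
Qed.

(** The value is itself coordinate 0, so its digits are the first variables after the parameter, as
    [digit_family] requires. *)
Definition box_family n D (F : seq (seq {poly {poly int}})) (t z : int) :=
  exists x : nat -> int, [/\ z = x 0%N,
    forall i, (i < n)%N -> 0 <= x i < t ^+ D.+1 & dnf (pform_sat n) F (t, x)].

Lemma definable_dnf_undigit n D F :
  definable (form_sat (n * D.+1).+1) (digit_box (n * D.+1))
    (fun y => dnf (pform_sat n) F (y 0%N, undigit D y)).
Proof.
have H (S : seq {poly {poly int}}) :
  definable (form_sat (n * D.+1).+1) (digit_box (n * D.+1))
    (fun y => forall p, p \in S -> pform_sat n p (y 0%N, undigit D y)).
  apply: (@definable_all _ _ _ _ S _ (fun p y => pform_sat n p (y 0%N, undigit D y))).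
  by move=> p; exact: definable_undigit.
apply: definable_ext (definable_ex F H) => y _; split.
  by move=> [c cF cy]; apply/hasP; exists c => //; exact/allP.
by move=> /hasP[c cF /allP cy]; exists c.
Qed.

Lemma qmax_box_family n D F : qmax false (box_family n.+1 D F).
Proof.
set m := (n.+1 * D.+1)%N.
have [G GE] := definable_dnf_undigit n.+1 D F.
(* The digit box as a system: [t - 1], every digit, and [t - 1] minus every digit are
   nonnegative. *)
pose box : seq {poly int} := [:: 'X - 1%:P] ++
  [seq 'X^(i.+2) | i <- iota 0 m] ++ [seq 'X - 1%:P - 'X^(i.+2) | i <- iota 0 m].
have boxE y : sol m.+1 box y <-> digit_box m y.
  have linT : lin m.+1 'X y = y 0%N by rewrite -['X]expr1 linX.
  rewrite !all_cat all_seq1 !all_map linB linC linT subr_ge0.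
  split=> [/and3P[y0 /allP H1 /allP H2]|[-> yb]].
    split=> // i im; have := H1 i; have := H2 i; rewrite mem_iota add0n im /=.
    rewrite !linB linC linT !linX// => /(_ isT) + /(_ isT) ->.
    by move: (y i.+1) (y 0%N) => a b; lia.
  apply/and3P; split=> //; apply/allP => i; rewrite mem_iota => im /=;
    have /andP[] := yb i im; rewrite ?linB ?linC ?linT !linX//.
  by move: (y i.+1) (y 0%N) => a b; lia.
have lem : (D.+1 <= m)%N by rewrite /m mulSn leq_addr.
apply: (@qmax_ext _ (fun t z => exists2 S, S \in G &
  digit_family D m.+1 'X (S ++ box) t z)).
  exists 1 => t t1 z; split.
    move=> [c cG [y [y0 -> ]]]; rewrite all_cat => /andP[cy /boxE yb].
    exists (undigit D y); split; first by rewrite /undigit hornerX y0.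
      move=> i lti; rewrite -y0; apply: digit_value_bound => j ltj.
      by apply: yb.2; rewrite /m; nia.
    by rewrite -y0; apply/(GE _ yb)/hasP; exists c.
  move=> [x [-> xb Fx]].
  have /choice[y yP] (i : nat) : exists y : nat -> int, (i < n.+1)%N ->
      (forall j, (j < D.+1)%N -> 0 <= y j < t) /\ x i = digit_value t D y.
    have [lti|_] := ltnP i n.+1; last by exists (fun=> 0).
    have [|y yt yE] := @digit_expansion t D (x i) _ (xb i lti); first by lia.
    by exists y.
  (* Concatenation of the digit strings of all coordinates, after the parameter. *)
  pose Y i := if i is k.+1 then y (k %/ D.+1)%N (k %% D.+1)%N else t.
  have Yu i : (i < n.+1)%N -> undigit D Y i = x i.
    move=> lti; rewrite (yP i lti).2; apply: eq_digit_value => j ltj /=.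
    by rewrite divnMDl// divn_small// addn0 modnMDl modn_small.
  have Yb : digit_box m Y.
    split=> // i im; have lti : (i %/ D.+1 < n.+1)%N by rewrite ltn_divLR.
    by rewrite (yP _ lti).1// ltn_mod.
  have : dnf (pform_sat n.+1) F (Y 0%N, undigit D Y).
    have <- // : dnf (pform_sat n.+1) F (t, x) =
        dnf (pform_sat n.+1) F (Y 0%N, undigit D Y).
    apply: eq_has => c; apply: eq_all => p; rewrite /pform_sat /=; congr (_ <= _).
    by apply: eq_lin => i /Yu.
  move=> /(GE _ Yb)/hasP[c cG cY]; exists c => //; exists Y; split=> //.
    by rewrite hornerX -(Yu 0%N).
  by rewrite all_cat cY; apply/boxE.
apply: qmax_big => S; apply: qmax_digit_family; first by rewrite ltnS.
exists 0 => y _; rewrite all_cat hornerX => /andP[_ /boxE[_ yb]] j jD.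
by apply: yb; apply: leq_trans jD lem.
Qed.

(** * Polynomial bounds by real elimination *)

Lemma ev_poly_bound (p : {poly int}) : exists D, ev (fun t => `|p.[t]| <= t ^+ D).
Proof.
elim/poly_ind: p => [|p c [D [N pN]]].
  by exists 0%N; exists 0 => t _; rewrite horner0 normr0.
(* One factor [t] comes from the multiplication by the indeterminate; the other absorbs [c], since
   [|c| <= t] and [t >= 2]. *)
exists D.+2; exists (`|N| + `|c| + 2) => t tN.
have {}pN : `|p.[t]| <= t ^+ D by apply: pN; lia.
have t2 : 2 <= t by lia.
have ct : `|c| <= t by lia.
rewrite hornerMXaddC (le_trans (ler_normD _ _))// normrM.
have T1 : 1 <= t ^+ D by apply: exprn_ege1; lia.
rewrite !exprS; rewrite [`|t|]ger0_norm; last lia.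
move: (t ^+ D) `|p.[t]| `|c| pN ct T1 => T P C PT Ct T1; nia.
Qed.

Section RealElimination.
Variable R : realFieldType.

Definition rparam (t : int) (p : {poly {poly int}}) : {poly R} :=
  map_poly (intr \o horner_eval t) p.

Lemma coef_rparam t p i : (rparam t p)`_i = (p`_i).[t]%:~R.
Proof. by rewrite coef_map. Qed.

Lemma rparamD t p q : rparam t (p + q) = rparam t p + rparam t q.
Proof. exact: rmorphD. Qed.

Lemma rparamZ t (c : {poly int}) p : rparam t (c *: p) = c.[t]%:~R *: rparam t p.
Proof. by rewrite /rparam map_polyZ. Qed.

Definition rsol n t (S : seq {poly {poly int}}) (x : nat -> R) :=
  sol n [seq rparam t p | p <- S] x.

Lemma rsol_cons n t p S x :
  rsol n t (p :: S) x = (0 <= lin n (rparam t p) x) && rsol n t S x.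
Proof. by []. Qed.

Lemma rsol_cat n t S S' x : rsol n t (S ++ S') x = rsol n t S x && rsol n t S' x.
Proof. by rewrite /rsol map_cat all_cat. Qed.

Lemma rsolP n t S x :
  reflect (forall p, p \in S -> 0 <= lin n (rparam t p) x) (rsol n t S x).
Proof. by rewrite /rsol all_map; exact: allP. Qed.

(** The pivots are integer polynomials in [t], so one splitting into lower bounds, upper bounds and
    side conditions is valid for all large [t]. *)
Lemma real_split n S : exists ls us cs : seq {poly {poly int}}, ev (fun t =>
  [/\ forall p, p \in ls -> 1 <= (p`_n.+1).[t],
      forall p, p \in us -> (p`_n.+1).[t] <= -1,
      forall p, p \in cs -> (p`_n.+1).[t] = 0
    & forall x, rsol n.+1 t S x =
        [&& rsol n.+1 t ls x, rsol n.+1 t us x & rsol n.+1 t cs x]]).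
Proof.
elim: S => [|p S [ls [us [cs IH]]]].
  by exists [::], [::], [::]; exists 0 => t _; split.
case: (poly_sign p`_n.+1) => [p0|p1|p1].
- exists ls, us, (p :: cs); move: IH; apply: ev_imp => t [H1 H2 H3 H4].
  split=> // [q|x]; first by rewrite inE => /predU1P[->|/H3//]; rewrite p0 horner0.
  by rewrite rsol_cons H4 andbCA; congr (_ && _); rewrite andbCA -rsol_cons.
- exists (p :: ls), us, cs; have := ev_and p1 IH.
  apply: ev_imp => t [p1t [H1 H2 H3 H4]].
  split=> // [q|x]; first by rewrite inE => /predU1P[->|/H1//].
  by rewrite !rsol_cons H4 andbA.
- exists ls, (p :: us), cs; have := ev_and p1 IH.
  apply: ev_imp => t [p1t [H1 H2 H3 H4]].
  split=> // [q|x]; first by rewrite inE => /predU1P[->|/H2//].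
  by rewrite rsol_cons H4 andbCA; congr (_ && _); rewrite andbA -rsol_cons.
Qed.

Lemma real_elim n S : exists S', ev (fun t => forall x,
  rsol n t S' x <-> exists y, rsol n.+1 t S (extend n x y)).
Proof.
have [ls [us [cs H]]] := real_split n S.
(* Cross-multiplication by the positive pivots cancels the last variable without division, so the
   coefficients stay in Z[t]. *)
pose comb (l u : {poly {poly int}}) := (- u`_n.+1) *: l + l`_n.+1 *: u.
exists ([seq comb l u | l <- ls, u <- us] ++ cs).
move: H; apply: ev_imp => t [lpos uneg c0 HS] x.
have csE y : rsol n.+1 t cs (extend n x y) = rsol n t cs x.
  rewrite /rsol !all_map; apply/eq_in_all => p /c0 /= p0.
  by rewrite lin_extend coef_rparam p0 mul0r addr0.
rewrite rsol_cat.
have cpos p : p \in ls -> 0 < (rparam t p)`_n.+1.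
  by move=> /lpos; rewrite coef_rparam ltr0z; lia.
have cneg p : p \in us -> (rparam t p)`_n.+1 < 0.
  by move=> /uneg; rewrite coef_rparam ltrz0; lia.
pose bd p := - lin n (rparam t p) x / (rparam t p)`_n.+1.
have lsE y : rsol n.+1 t ls (extend n x y) = all (fun l => l <= y) [seq bd p | p <- ls].
  rewrite /rsol !all_map; apply/eq_in_all => p /cpos p0 /=.
  by rewrite lin_extend ler_pdivrMr// -[RHS]subr_ge0; congr (_ <= _); ring.
have usE y : rsol n.+1 t us (extend n x y) = all (fun u => y <= u) [seq bd p | p <- us].
  rewrite /rsol !all_map; apply/eq_in_all => p /cneg p0 /=.
  by rewrite lin_extend ler_ndivlMr// -[RHS]subr_ge0; congr (_ <= _); ring.
have -> : rsol n t [seq comb l u | l <- ls, u <- us] x =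
    allrel <=%R [seq bd p | p <- ls] [seq bd p | p <- us].
  have E l u : l \in ls -> u \in us ->
      (0 <= lin n (rparam t (comb l u)) x) = (bd l <= bd u).
    move=> /cpos l0 /cneg u0; rewrite /bd /comb.
    rewrite rparamD !rparamZ linD !linZ hornerN mulrNz -!coef_rparam.
    move: (lin _ _ _) (lin _ _ _) (rparam t l)`_n.+1 (rparam t u)`_n.+1 l0 u0.
    move=> a b c d c0' d0; rewrite ler_pdivrMr// mulrAC ler_ndivlMr//.
    by rewrite -[RHS]subr_ge0; congr (_ <= _); ring.
  apply/rsolP/allrelP => [H _ _ /mapP[l lls ->] /mapP[u uus ->]|H].
    by rewrite -E//; apply: H; apply/allpairsP; exists (l, u).
  move=> _ /allpairsP[[l u] /= [lls uus ->]]; rewrite E//.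
  by apply: H; apply: map_f.
split=> [/andP[/ex_between[y [yl yu]] cx]|[y]].
  by exists y; rewrite HS lsE usE csE yl yu.
rewrite HS lsE usE csE => /and3P[yl yu ->]; rewrite andbT.
by apply/ex_between; exists y.
Qed.

Lemma real_project n S : exists S', ev (fun t => forall u,
  rsol 1 t S' (fun=> u) <-> exists x, x 0%N = u /\ rsol n.+1 t S x).
Proof.
elim: n S => [|n IHn] S.
  exists S; exists 0 => t _ u; split=> [Su|[x [<-]]]; first by exists (fun=> u).
  by congr is_true; apply: eq_sol_lin => -[].
have [S1 H1] := real_elim n.+1 S; have [S2 H2] := IHn S1.
exists S2; have := ev_and H1 H2; apply: ev_imp => t [{}H1 {}H2] u.
rewrite H2; split=> [[x [<- /H1[y Sy]]]|[x [<- Sx]]].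
  by exists (extend n.+1 x y).
exists x; split=> //; apply/H1; exists (x n.+1).
rewrite /rsol (@eq_sol_lin _ _ _ _ x)// => i lti; rewrite /extend.
by case: ltnP => // lei; have -> : i = n.+1 by lia.
Qed.

(** After projection to variable 0, an upper constraint reads [u_0 + u_1 * y >= 0] with [u_1 <= -1].
    Hence [y] is at most the larger of [u_0] and 0, and [u_0] is a polynomial in [t]. *)
Lemma real_bound0 n S :
  ev (fun t => exists B, forall x, rsol n.+1 t S x -> x 0%N <= B) ->
  exists D, ev (fun t => forall x, rsol n.+1 t S x -> x 0%N <= t%:~R ^+ D).
Proof.
have [S' H] := real_project n S; have [ls [us [cs H']]] := real_split 0 S'.
case: us H' => [|u us] H' bS.
  (* Without an upper constraint any point could be moved beyond [B], so the system has no
     solution. *)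
  exists 0%N; have := ev_and bS (ev_and H H').
  apply: ev_imp => t [[B HB] [{}H [lpos _ c0 HS]]] x Sx; exfalso.
  have : rsol 1 t S' (fun=> Num.max (x 0%N) (B + 1)).
    have : rsol 1 t S' (fun=> x 0%N) by apply/H; exists x.
    rewrite !HS => /andP[/rsolP lx /andP[_ /rsolP cx]].
    apply/and3P; split=> //; apply/rsolP => p ps.
      have := lx _ ps; rewrite !lin_recr => /le_trans; apply.
      rewrite [leLHS]addrC [leRHS]addrC lerD//; last first.
        by rewrite /lin !big_ord0.
      rewrite ler_wpM2l ?le_max ?lexx// coef_rparam ler0z.
      by have := lpos _ ps; lia.
    have := cx _ ps; rewrite !lin_recr coef_rparam c0// !mul0r /lin !big_ord0//.
  move=> /H[x' [x'0 /HB]]; rewrite x'0 leNgt lt_max.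
  by rewrite ltrDl ltr01 orbT.
have [D HD] := ev_poly_bound (u`_0); exists D.
have := ev_and (ev_ge 1) (ev_and HD (ev_and H H')).
apply: ev_imp => t [t1 [{}HD [{}H [_ uneg _ HS]]]] x Sx.
have : rsol 1 t S' (fun=> x 0%N) by apply/H; exists x.
rewrite HS => /and3P[_ /rsolP/(_ u (mem_head _ _)) + _].
rewrite /lin big_ord1 !coef_rparam.
have : ((u`_1).[t]%:~R <= -1 :> R).
  by rewrite (_ : -1 = (-1)%:~R)// ler_int; apply: uneg; rewrite mem_head.
have : ((u`_0).[t]%:~R <= t%:~R ^+ D :> R).
  by rewrite -rmorphXn ler_int (le_trans (ler_norm _)).
have : (0 <= t%:~R ^+ D :> R) by rewrite exprn_ge0// ler0z; lia.
move: ((u`_0).[t]%:~R : R) ((u`_1).[t]%:~R : R) (t%:~R ^+ D : R) (x 0%N).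
by move=> a b T y; nra.
Qed.

Definition shift_form (p : {poly {poly int}}) := (p`_0)%:P + 'X * (p - (p`_0)%:P).

Lemma lin_shift_form n t p x :
  lin n.+1 (rparam t (shift_form p)) x = lin n (rparam t p) (fun i => x i.+1).
Proof.
rewrite /lin big_ord_recl !coef_rparam /shift_form !coefD !coefC !coefXM /=.
rewrite coefB coefC /= subrr addr0 add0r horner0 mul0r add0r; congr (_ + _).
apply: eq_bigr => i _.
by rewrite !coef_rparam coefD coefC coefXM coefB coefC /= subr0 add0r.
Qed.

(** A new variable 0 constrained to be at most [f] reduces this to the bound on a variable;
    [shift_form] makes room for it. *)
Lemma real_bound n S (f : {poly {poly int}}) :
  ev (fun t => exists B, forall x, rsol n t S x -> lin n (rparam t f) x <= B) ->
  exists D, ev (fun t => forall x, rsol n t S x ->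
    lin n (rparam t f) x <= t%:~R ^+ D).
Proof.
move=> bS; pose S' := (shift_form f - 'X) :: map shift_form S.
have S'E t x : rsol n.+1 t S' x =
    (x 0%N <= lin n (rparam t f) (fun i => x i.+1)) && rsol n t S (fun i => x i.+1).
  rewrite /S' rsol_cons; congr (_ && _).
    rewrite rparamD linD lin_shift_form -scaleN1r rparamZ linZ hornerN hornerC.
    by rewrite mulN1r /rparam map_polyX -['X]expr1 linX// subr_ge0.
  rewrite /rsol !all_map; apply: eq_all => p /=; by rewrite lin_shift_form.
have [|D HD] := @real_bound0 n S'.
  move: bS; apply: ev_imp => t [B HB]; exists B => x.
  by rewrite S'E => /andP[/le_trans xf /HB /xf].
exists D; move: HD; apply: ev_imp => t HD x Sx.
apply: (HD (fun i => if i is j.+1 then x j else lin n (rparam t f) x)).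
by rewrite S'E lexx.
Qed.

End RealElimination.

(** * The l-th largest value *)

Section KthLargest.
Variables (T : choiceType) (R : realType) (h : T -> R) (S : set T).
Hypothesis finS : finite_set S.

(** The index [k] counts from 0. Conversely, among [k.+1] distinct points one has rank at least [k]
    in the sorted enumeration, so the entry of rank [k] is at least its value. *)
Lemma kth_largest_geP k (v : R) :
  (k < size (sorted_values h S))%N && (v <= (sorted_values h S)`_k) <->
  exists x : nat -> T, [/\ forall i, (i <= k)%N -> S (x i),
    forall i, (i <= k)%N -> v <= h (x i) &
    forall i j, (i < j <= k)%N -> x i <> x j].
Proof.
(* Sorting the points rather than their values keeps track of multiplicities: [e] has no repetition
   even where [h] does. *)
pose e := sort (relpre h >=%R) (finmap.enum_fset (fset_set S)).
have sE : sorted_values h S = map h e by rewrite /sorted_values sort_map.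
have eS x : (x \in e) = (x \in S) by rewrite mem_sort in_fset_set.
have eU : uniq e by rewrite sort_uniq finmap.fset_uniq.
have dec i j : (i <= j)%N -> (j < size e)%N -> (map h e)`_j <= (map h e)`_i.
  move=> ij je; rewrite -sE.
  have := @sorted_leq_nth _ >=%R ge_trans ge_refl 0 (sorted_values h S).
  apply=> //; rewrite ?inE ?sE ?size_map//; last exact: leq_ltn_trans je.
  by rewrite -sE /sorted_values; apply: sort_sorted => a b; exact: le_total.
rewrite sE size_map; split=> [/andP[ke vk]|[x [xS xv xx]]].
  have [x0 _] : exists x0 : T, true by move: ke; case: (e) => // a ? _; exists a.
  have lte i : (i <= k)%N -> (i < size e)%N by move=> ik; exact: leq_ltn_trans ke.
  exists (nth x0 e); split=> [i ik|i ik|i j /andP[ij jk] eij].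
  - by have := mem_nth x0 (lte i ik); rewrite eS in_setE.
  - by rewrite (le_trans vk)// (le_trans (dec i k ik ke))// (nth_map x0) ?lte.
  - have := nth_uniq x0 (lte i (ltnW (leq_trans ij jk))) (lte j jk) eU.
    by rewrite eij eqxx => /esym/eqP ijE; rewrite ijE ltnn in ij.
have xe i : (i <= k)%N -> x i \in e by move=> ik; rewrite eS in_setE; exact: xS.
have [//|kn] := boolP ((k < size e)%N && (v <= (map h e)`_k)); exfalso.
have idx i : (i <= k)%N -> (index (x i) e < k)%N.
  move=> ik; rewrite ltnNge; apply/negP => ki.
  have ie : (index (x i) e < size e)%N by rewrite index_mem xe.
  move: kn; rewrite (leq_ltn_trans ki ie) /= => /negP; apply.
  rewrite (le_trans (xv i ik))// (le_trans _ (dec _ _ ki ie))//.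
  by rewrite (nth_map (x i))// nth_index ?xe.
have : (size [seq index (x i) e | i <- iota 0 k.+1] <= size (iota 0 k))%N.
  apply: uniq_leq_size => [|y /mapP[i]]; last first.
    by rewrite mem_iota add0n ltnS => /idx + ->; rewrite mem_iota.
  rewrite map_inj_in_uniq ?iota_uniq// => i j.
  rewrite !mem_iota !add0n !ltnS => /= ik jk ij.
  have xij : x i = x j by rewrite -(nth_index (x i) (xe i ik)) ij nth_index ?xe.
  have [lij|lji|//] := ltngtP i j.
    by case: (xx i j); rewrite ?lij.
  by case: (xx j i); rewrite ?lji.
by rewrite size_map !size_iota ltnn.
Qed.

End KthLargest.

Lemma qmax_eventually_quasi_polynomial (R : realType) X (g : int -> \bar R) :
  qmax false X ->
  ev (fun t => forall o, max_is (X t) o ->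
    g t = oapp (fun v : int => (v%:~R)%:E) (-oo)%E o) ->
  eventually_quasi_polynomial [set t : int | 0 < t] g.
Proof.
move=> [[[|M]|]// _ H] gX; set d := M.+1; split.
  by exists 1 => t /=; lia.
have /choice[q qP] : forall r : int, exists o : option {poly int},
    ev (fun t => max_is (X (d%:Z * t + r)) (omap (horner^~ t) o)).
  by move=> r; have [p _ pX] := H r; exists p.
(* The maxima are polynomials in the quotient [(t - j) / d]; this rewrites them as polynomials in
   [t]. *)
pose conv (j : int) (p : {poly int}) : {poly R} :=
  map_poly intr p \Po (d%:R^-1 *: ('X - (j%:~R)%:P)).
exists d, (fun j : 'I_d => omap (conv j) (q j%:Z)); split=> //.
have [N' HN'] : ev (fun t => forall j : 'I_d, j \in enum 'I_d ->
    max_is (X (d%:Z * t + j%:Z)) (omap (horner^~ t) (q j%:Z))).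
  by apply: ev_all => j _; exact: qP.
have [N HN] := gX.
(* Large enough for [t] to exceed [N] and for its quotient by [d] to exceed [N']. *)
exists (`|N| + d%:Z * (`|N'| + 1)) => t tN _ j tj.
have tE := divz_eq t d; set t' := (t %/ d)%Z in tE.
have t'N : N' <= t'.
  have := ltn_ord j; move: tN; rewrite {1}tE tj => tN jd.
  rewrite leNgt; apply/negP => t'N.
  have : t' * d%:Z <= (`|N'| - 1) * d%:Z by rewrite ler_wpM2r//; lia.
  by lia.
have jmax := HN' _ t'N j (mem_enum _ _).
have -> : g t = oapp (fun v : int => (v%:~R)%:E) (-oo)%E
    (omap (horner^~ t') (q j%:Z)).
  apply: HN; first by lia.
  by rewrite tE tj mulrC.
case: (q j%:Z) => //= p; congr EFin.
rewrite /conv horner_comp hornerZ hornerXsubC.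
rewrite tE tj rmorphD /= addrK rmorphM /= mulrC mulfK ?pnatr_eq0//.
by rewrite horner_map.
Qed.

(** * Tuples of lattice points as solutions of systems over Z[t] *)

Definition param_affine n (g : int * (nat -> int) -> int) :=
  exists p, forall u, lin n (at_param u.1 p) u.2 = g u.

Lemma param_affine_poly n (q : {poly int}) : param_affine n (fun u => q.[u.1]).
Proof. by exists q%:P => u; rewrite /at_param map_polyC linC. Qed.

Lemma param_affine_var n i : (i < n)%N -> param_affine n (fun u => u.2 i).
Proof. by move=> lti; exists 'X^(i.+1) => u; rewrite /at_param map_polyXn linX. Qed.

Lemma param_affineD n g h : param_affine n g -> param_affine n h ->
  param_affine n (fun u => g u + h u).
Proof.
by move=> [p pE] [q qE]; exists (p + q) => u; rewrite /at_param rmorphD linD pE qE.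
Qed.

Lemma param_affineM n (q : {poly int}) g : param_affine n g ->
  param_affine n (fun u => q.[u.1] * g u).
Proof.
by move=> [p pE]; exists (q *: p) => u; rewrite /at_param map_polyZ linZ pE.
Qed.

Lemma param_affineN n g : param_affine n g -> param_affine n (fun u => - g u).
Proof.
by move=> [p pE]; exists (- p) => u; rewrite /at_param rmorphN linN pE.
Qed.

Lemma param_affine_sum n I (r : seq I) g : (forall i, param_affine n (g i)) ->
  param_affine n (fun u => \sum_(i <- r) g i u).
Proof.
move=> /choice[p pE]; exists (\sum_(i <- r) p i) => u.
by rewrite /at_param rmorph_sum lin_sum; apply: eq_bigr => i _; exact: pE.
Qed.

Lemma definable_ge0 n B g : param_affine n g ->
  definable (pform_sat n) B (fun u => 0 <= g u).
Proof.
move=> [p pE]; apply: definable_ext (definable_atom (pform_sat n) B p) => u _.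
by rewrite /pform_sat pE.
Qed.

Definition lform n (a0 : {poly int}) (a : 'I_n -> {poly int}) :
  {poly {poly int}} := a0%:P + \sum_(j < n) a j *: 'X^(j.+1).

Lemma lin_lform (R : realFieldType) n a0 (a : 'I_n -> {poly int}) t (x : nat -> R) :
  lin n (rparam R t (lform a0 a)) x =
  (a0.[t])%:~R + \sum_(j < n) ((a j).[t])%:~R * x j.
Proof.
rewrite /lform rparamD linD {1}/rparam map_polyC linC; congr (_ + _).
have -> : rparam R t (\sum_(j < n) a j *: 'X^(j.+1)) =
    \sum_(j < n) rparam R t (a j *: 'X^(j.+1)) by rewrite /rparam rmorph_sum.
rewrite lin_sum; apply: eq_bigr => j _.
by rewrite rparamZ linZ /rparam map_polyXn linX.
Qed.

Section IntegerPoints.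
Variables (R : realType) (n m : nat) (c : 'cV[{poly int}]_n)
  (A : 'M[{poly int}]_(m, n)) (b : 'cV[{poly int}]_m).

Definition int_feasible (t : int) (y : nat -> int) :=
  forall i : 'I_m, \sum_(j < n) (A i j).[t] * y j <= (b i 0).[t].

Definition int_objective (t : int) (y : nat -> int) : int :=
  \sum_(j < n) (c j 0).[t] * y j.

Definition embed (y : nat -> int) : 'cV[R]_n := \col_i (y i)%:~R.

Lemma embed_feasible t y : polyhedron R A b t (embed y) <-> int_feasible t y.
Proof.
have E i : ((eval_mx R A t *m embed y) i 0 <= eval_mx R b t i 0) =
    (\sum_(j < n) (A i j).[t] * y j <= (b i 0).[t]).
  rewrite !mxE -(ler_int R) rmorph_sum; congr (_ <= _); apply: eq_bigr => j _.
  by rewrite !mxE rmorphM.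
by split=> H i; have := H i; rewrite E.
Qed.

Lemma lattice_points_embed t y :
  lattice_points R A b t (embed y) <-> int_feasible t y.
Proof.
split=> [[/embed_feasible]//|Hy]; split; first exact/embed_feasible.
by move=> i; rewrite mxE intr_int.
Qed.

Lemma lattice_pointsP t x : lattice_points R A b t x -> exists y, x = embed y.
Proof.
move=> [_ xi]; have /choice[y yE] : forall i : 'I_n, exists z : int, x i 0 = z%:~R.
  by move=> i; apply/intrP; exact: xi.
exists (fun i => oapp y 0 (insub i)); apply/matrixP => i j.
by rewrite ord1 mxE valK yE.
Qed.

Lemma objective_embed t y : objective c t (embed y) = (int_objective t y)%:~R.
Proof.
rewrite /objective mxE rmorph_sum; apply: eq_bigr => j _.
by rewrite !mxE rmorphM.
Qed.

Definition constraints : seq {poly {poly int}} :=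
  [seq lform (b i 0) (fun j => - A i j) | i <- enum 'I_m].

Lemma rsol_constraints t (x : nat -> R) :
  rsol n t constraints x <-> polyhedron R A b t (\col_i x i).
Proof.
have E i : (0 <= lin n (rparam R t (lform (b i 0) (fun j => - A i j))) x) =
    ((eval_mx R A t *m (\col_i x i)) i 0 <= eval_mx R b t i 0).
  rewrite lin_lform !mxE -[RHS]subr_ge0 -sumrN; congr (_ <= _ + _).
  by apply: eq_bigr => j _; rewrite !mxE hornerN mulrNz mulNr.
split=> [/rsolP H i|H]; first by rewrite -E; apply/H/map_f; rewrite mem_enum.
by apply/rsolP => _ /mapP[i _ ->]; rewrite E; exact: H.
Qed.

Hypothesis bounded_polyhedron : forall t : int, 0 < t -> bounded_set (polyhedron R A b t).

Lemma polyhedron_coord_bounded t : 0 < t -> exists B : R, forall x,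
  polyhedron R A b t x -> forall i, `|x i 0| <= B.
Proof.
move=> /bounded_polyhedron[B [_ HB]]; exists (B + 1) => x Px i.
have B1 : B < B + 1 by rewrite ltrDl.
have := HB (B + 1) B1 x Px; apply: le_trans.
rewrite [leRHS]/Num.Def.normr /= mx_normrE; apply/bigmax_geP; right => /=.
by exists (i, 0).
Qed.

Lemma form_bound (f : {poly {poly int}}) : exists D, ev (fun t =>
  forall x, rsol n t constraints x -> lin n (rparam R t f) x <= t%:~R ^+ D).
Proof.
apply: real_bound; exists 1 => t t1.
have [|B HB] := @polyhedron_coord_bounded t; first by lia.
exists (`|(rparam R t f)`_0| + \sum_(i < n) `|(rparam R t f)`_i.+1| * B).
move=> x /rsol_constraints/HB{}HB; rewrite lerD ?ler_norm//.
apply: ler_sum => i _; rewrite (le_trans (ler_norm _))// normrM ler_wpM2l//.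
by have := HB i; rewrite mxE.
Qed.

Lemma forms_bound (fs : seq {poly {poly int}}) : exists D, ev (fun t =>
  forall f, f \in fs -> forall x, rsol n t constraints x ->
    lin n (rparam R t f) x <= t%:~R ^+ D).
Proof.
elim: fs => [|f fs [D HD]]; first by exists 0%N; exists 0.
have [D' HD'] := form_bound f; exists (maxn D D').
have := ev_and (ev_ge 1) (ev_and HD HD').
apply: ev_imp => t [t1 [{}HD {}HD']] g.
have t1R : 1 <= t%:~R :> R by rewrite (ler_int R 1).
rewrite inE => /predU1P[->|/HD{}HD] x => [/HD'|/HD] /le_trans; apply.
  by rewrite ler_weXn2l// leq_maxr.
by rewrite ler_weXn2l// leq_maxl.
Qed.

(** The one-sided bound on forms is applied to each coordinate, to the objective and to their
    opposites. *)
Lemma int_bound : exists D, ev (fun t => forall y, int_feasible t y ->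
  (forall j, (j < n)%N -> `|y j| <= t ^+ D) /\ `|int_objective t y| <= t ^+ D).
Proof.
pose e (j i : 'I_n) : {poly int} := (i == j)%:R.
pose fs := [seq lform 0 (e j) | j <- enum 'I_n] ++
  [seq lform 0 (fun i => - e j i) | j <- enum 'I_n] ++
  [:: lform 0 (fun i => c i 0); lform 0 (fun i => - c i 0)].
have [D HD] := forms_bound fs; exists D; move: HD; apply: ev_imp => t HD y.
move=> /embed_feasible/(rsol_constraints t (fun i => (y i)%:~R)) Hy.
have {}HD f : f \in fs -> lin n (rparam R t f) (fun i => (y i)%:~R) <= (t ^+ D)%:~R.
  by move=> /HD/(_ _ Hy); rewrite rmorphXn.
split=> [j ltj|].
  have eE : \sum_(i < n) (e (Ordinal ltj) i).[t]%:~R * (y i)%:~R = (y j)%:~R :> R.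
    rewrite (bigD1 (Ordinal ltj))//= big1 ?addr0 => [|i /negbTE ij].
      by rewrite /e eqxx hornerC mul1r.
    by rewrite /e ij horner0 mul0r.
  rewrite ler_norml -!(ler_int R) mulrNz lerNl.
  have := HD (lform 0 (e (Ordinal ltj))); rewrite lin_lform horner0 add0r eE.
  rewrite mem_cat (map_f (fun j => lform 0 (e j))) ?mem_enum//.
  move=> /(_ isT) ->; rewrite andbT.
  have := HD (lform 0 (fun i => - e (Ordinal ltj) i)).
  rewrite !mem_cat (map_f (fun j => lform 0 (fun i => - e j i))) ?mem_enum// orbT.
  rewrite lin_lform horner0 add0r => /(_ isT).
  rewrite (eq_bigr (fun i : 'I_n => - ((e (Ordinal ltj) i).[t]%:~R * (y i)%:~R))).
    by rewrite sumrN eE.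
  by move=> i _; rewrite hornerN mulrNz mulNr.
have oE : \sum_(i < n) (c i 0).[t]%:~R * (y i)%:~R = (int_objective t y)%:~R :> R.
  by rewrite rmorph_sum; apply: eq_bigr => i _; rewrite rmorphM.
rewrite ler_norml -!(ler_int R) mulrNz lerNl.
have := HD (lform 0 (fun i => c i 0)); rewrite lin_lform horner0 add0r oE.
rewrite !mem_cat mem_head !orbT => /(_ isT) ->; rewrite andbT.
have := HD (lform 0 (fun i => - c i 0)).
rewrite !mem_cat !inE eqxx !orbT lin_lform horner0 add0r => /(_ isT).
rewrite (eq_bigr (fun i : 'I_n => - ((c i 0).[t]%:~R * (y i)%:~R))).
  by rewrite sumrN oE.
by move=> i _; rewrite hornerN mulrNz mulNr.
Qed.

Lemma finite_lattice_points : ev (fun t => finite_set (lattice_points R A b t)).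
Proof.
have [D HD] := int_bound; have := ev_and (ev_ge 1) HD.
apply: ev_imp => t [t1 {}HD]; pose B := absz (t ^+ D).
pose g (f : {ffun 'I_n -> 'I_(B + B).+1}) : 'cV[R]_n :=
  \col_i ((f i)%:Z - B%:Z)%:~R.
apply: (@sub_finite_set _ _ (range g)); last first.
  by apply: finite_image; exact: finite_finset.
move=> x Lx; have [y xy] := lattice_pointsP Lx.
move: Lx; rewrite xy => /lattice_points_embed/HD[yb _].
exists [ffun i : 'I_n => inord (absz (y i + B%:Z))] => //.
apply/matrixP => i j; rewrite !mxE ffunE; congr (_%:~R).
have := yb i (ltn_ord i).
have -> : t ^+ D = B%:Z by rewrite /B gez0_abs// exprn_ge0//; lia.
by move: (y i) => z zb; rewrite inordK; lia.
Qed.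

(** Distinctness is witnessed by a coordinate below [n]: it becomes a finite disjunction, and values
    beyond the first [n] are irrelevant. *)
Definition config k (t v : int) (x : nat -> nat -> int) :=
  [/\ forall i, (i <= k)%N -> int_feasible t (x i),
      forall i, (i <= k)%N -> v <= int_objective t (x i)
    & forall i j, (i < j <= k)%N -> exists2 s, (s < n)%N & x i s != x j s].

Definition values k (t v : int) := exists x, config k t v x.

(** By [kth_largest_geP], [values k t] consists of the integers up to the sorted entry of rank [k],
    and is empty if there is no such entry. That entry is an integer, hence the maximum. *)
Lemma kth_largest_values k t o : finite_set (lattice_points R A b t) ->
  max_is (values k t) o ->
  param_kth_largest R c A b k.+1 t = oapp (fun v : int => (v%:~R)%:E) (-oo)%E o.
Proof.
move=> finL omax; rewrite /param_kth_largest /kth_largest /=.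
set h := objective c t; set L := lattice_points R A b t in finL *.
have valuesP (v : int) : values k t v <->
    ((k < size (sorted_values h L))%N && (v%:~R <= (sorted_values h L)`_k)).
  rewrite (kth_largest_geP h finL); split=> [[x [xf xv xx]]|[x [xL xv xx]]].
    exists (fun i => embed (x i)); split=> [i ik|i ik|i j ijk].
    - exact/lattice_points_embed/xf.
    - by rewrite /h objective_embed ler_int xv.
    - have [s sn /eqP ne] := xx i j ijk; move=> /matrixP/(_ (Ordinal sn) 0).
      by rewrite !mxE => /intr_inj.
  have /choice[y yE] : forall i, exists y, (i <= k)%N -> x i = embed y.
    move=> i; have [ik|_] := leqP i k; last by exists (fun=> 0).
    by have [y] := lattice_pointsP (xL i ik); exists y.
  exists y; split=> [i ik|i ik|i j ijk].
  - by apply/lattice_points_embed; rewrite -yE//; exact: xL.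
  - by rewrite -(ler_int R) -objective_embed -yE//; exact: xv.
  - have /andP[ij jk] := ijk.
    have [//|ne] := pselect (exists2 s, (s < n)%N & y i s != y j s).
    case: (xx i j ijk); rewrite !yE ?(ltnW (leq_trans ij jk))//.
    apply/matrixP => s z; rewrite !mxE; congr (_%:~R).
    by apply/eqP/negPn/negP => ys; apply: ne; exists s.
have kE : (k < size (sorted_values h L))%N ->
    exists2 v : int, (sorted_values h L)`_k = v%:~R & values k t v.
  move=> ks; have : (sorted_values h L)`_k \in sorted_values h L by exact: mem_nth.
  rewrite mem_sort => /mapP[x]; rewrite in_fset_set// in_setE => Lx hx.
  have [y xy] := lattice_pointsP Lx; exists (int_objective t y).
    by rewrite hx xy /h objective_embed.
  by apply/valuesP; rewrite ks hx xy /h objective_embed lexx.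
case: o omax => [v [/valuesP/andP[ks vk] vmax]|vn] /=.
  rewrite (nth_map 0)//; have [w wE /vmax wv] := kE ks.
  by congr EFin; apply/eqP; rewrite eq_le vk wE ler_int wv.
have [ks|ks] := ltnP k (size (sorted_values h L)); last by rewrite nth_default ?size_map.
by have [w _ /vn] := kE ks.
Qed.

(* Points and value are translated by t^D to become nonnegative. *)
Definition shifted_value D (u : int * (nat -> int)) : int := u.2 0%N - u.1 ^+ D.

Definition shifted_points D (u : int * (nat -> int)) (i s : nat) : int :=
  u.2 (i * n + s).+1 - u.1 ^+ D.

Lemma definable_config k D :
  definable (pform_sat (k.+1 * n).+1) (fun=> True)
    (fun u => config k u.1 (shifted_value D u) (shifted_points D u)).
Proof.
set N := (k.+1 * n).+1.
have XD : param_affine N (fun u => - u.1 ^+ D).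
  have [p pE] := param_affineN (param_affine_poly N 'X^D).
  by exists p => u; rewrite pE hornerXn.
have pt i s : (i <= k)%N -> (s < n)%N -> param_affine N (fun u => shifted_points D u i s).
  move=> ik sn; apply: param_affineD XD; apply: param_affine_var.
  by rewrite /N ltnS; nia.
have dot i (a : 'I_n -> {poly int}) : (i <= k)%N ->
    param_affine N (fun u => \sum_(j < n) (a j).[u.1] * shifted_points D u i j).
  move=> ik; apply: param_affine_sum => j; apply: param_affineM; exact: pt.
pose F i u := int_feasible u.1 (shifted_points D u i).
pose G i u := shifted_value D u <= int_objective u.1 (shifted_points D u i).
pose H i j u := exists2 s, (s < n)%N & shifted_points D u i s != shifted_points D u j s.
have dF i : definable (pform_sat N) (fun=> True) (fun u => (i <= k)%N -> F i u).
  (* Out of range the implication is vacuous, and a single empty conjunction expresses truth. *)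
  have [ik|_] := leqP i k; last by exists [:: [::]] => u _.
  apply: definable_ext (definable_all (enum 'I_m) (X := fun r u =>
    0 <= (b r 0).[u.1] + - \sum_(j < n) (A r j).[u.1] * shifted_points D u i j) _).
    move=> u _; split=> [Hr _ r|Hr r _]; first by rewrite -subr_ge0 Hr ?mem_enum.
    by rewrite subr_ge0; exact: Hr.
  move=> r; apply: definable_ge0; apply: param_affineD.
    exact: param_affine_poly.
  exact/param_affineN/dot.
have dG i : definable (pform_sat N) (fun=> True) (fun u => (i <= k)%N -> G i u).
  have [ik|_] := leqP i k; last by exists [:: [::]] => u _.
  apply: definable_ext (definable_ge0 (n := N) (fun=> True) (g := fun u =>
    int_objective u.1 (shifted_points D u i) + - (u.2 0%N + - u.1 ^+ D)) _).
    by move=> u _; rewrite subr_ge0; split=> // /(_ isT).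
  apply: param_affineD; first exact: dot.
  by apply: param_affineN; apply: param_affineD => //; exact: param_affine_var.
have dH i j : definable (pform_sat N) (fun=> True) (fun u => (i < j <= k)%N -> H i j u).
  have [/andP[ij jk]|_] := boolP (i < j <= k)%N; last by exists [:: [::]] => u _.
  have ik := ltnW (leq_trans ij jk).
  (* Over the integers, strict inequality means that the difference minus 1 is nonnegative. *)
  pose gap i j s u :=
    0 <= shifted_points D u i s + - shifted_points D u j s + (- 1%:P).[u.1].
  have dgap i' j' (s : 'I_n) : (i' <= k)%N -> (j' <= k)%N ->
      definable (pform_sat N) (fun=> True) (gap i' j' s).
    move=> ik' jk'; apply: definable_ge0; apply: param_affineD.
      by apply: param_affineD; [exact: pt|apply: param_affineN; exact: pt].
    exact: param_affine_poly.
  apply: definable_ext (definable_ex (enum 'I_n) (fun s =>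
    definable_or (dgap i j s ik jk) (dgap j i s jk ik))) => u _.
  have gapE i' j' s : gap i' j' s u = (shifted_points D u j' s < shifted_points D u i' s).
    rewrite /gap hornerN hornerC.
    by move: (shifted_points _ _ _ _) (shifted_points _ _ _ _) => x y; lia.
  split=> [[s _]|/(_ isT)[s sn]].
    rewrite !gapE => ne _; exists (s : nat) => //.
    by case: ne => [/gt_eqF->|/lt_eqF->].
  rewrite neq_lt => ne; exists (Ordinal sn); first by rewrite mem_enum.
  by rewrite !gapE; case/orP: ne; [right|left].
pose ks := iota 0 k.+1.
apply: definable_ext (definable_and (definable_and (definable_all ks dF)
  (definable_all ks dG)) (definable_all ks (fun i => definable_all ks (dH i)))) => u _.
have ksE i : (i \in ks) = (i <= k)%N by rewrite mem_iota.
split=> [[[HF HG] HH]|[HF HG HH]].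
  split=> [i ik|i ik|i j ijk]; [apply: HF|apply: HG|apply: HH]; rewrite ?ksE//.
    by case/andP: ijk => ij jk; exact: ltnW (leq_trans ij jk).
  by case/andP: ijk.
by split; [split|] => i; rewrite ksE; [move=> _; exact: HF|move=> _; exact: HG|
  move=> _ j _; exact: HH].
Qed.

Lemma qmax_values k : qmax false (values k).
Proof.
have [D HD] := int_bound; have [F HF] := definable_config k D.
apply: (@qmax_affine false 1 (- 'X^D) _ _ isT _ (qmax_box_family (k.+1 * n) D F)).
(* With [t >= 3], the translated range [[0, 2 * T]] fits strictly below [t ^+ D.+1]. *)
have := ev_and (ev_ge 3) HD; apply: ev_imp => t [t3 {}HD].
set T := t ^+ D; have T0 : 0 < T by rewrite exprn_gt0//; lia.
have TT z : `|z| <= T -> 0 <= z + T < t ^+ D.+1.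
  move=> zT; have : 3 * T <= t * T by rewrite ler_wpM2r// ltW.
  by rewrite exprS -/T; move: (t * T) => tT; lia.
have fwd z : box_family (k.+1 * n).+1 D F t z -> values k t (z - T).
  move=> [x [-> _ /(HF (t, x) I) Cx]]; by exists (shifted_points D (t, x)).
have bwd v : values k t v -> - T <= v -> box_family (k.+1 * n).+1 D F t (v + T).
  move=> [x [xf xv xx]] vT.
  pose z i := if i is i'.+1 then x (i' %/ n)%N (i' %% n)%N + T else v + T.
  have zE i s : (s < n)%N -> shifted_points D (t, z) i s = x i s.
    move=> sn; rewrite /shifted_points /= addrK.
    by rewrite divnMDl ?(leq_ltn_trans _ sn)// divn_small// addn0 modnMDl modn_small.
  exists z; split=> // [[_|i]|].
  - apply: TT; have [_] := HD _ (xf 0%N isT).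
    by have := xv 0%N isT; move: (int_objective _ _) => w; lia.
  - rewrite ltnS => ltik; have n0 : (0 < n)%N by case: (n) ltik => //; rewrite muln0.
    apply: TT; have ik : (i %/ n <= k)%N by rewrite -ltnS ltn_divLR.
    by apply: (HD _ (xf _ ik)).1; rewrite ltn_mod.
  - apply/(HF (t, z) I); have sumE i (a : 'I_n -> {poly int}) :
        \sum_(j < n) (a j).[t] * shifted_points D (t, z) i j =
        \sum_(j < n) (a j).[t] * x i j.
      by apply: eq_bigr => j _; rewrite zE.
    split=> [i ik r|i ik|i j ijk]; rewrite /=.
    + by rewrite sumE; exact: xf.
    + by rewrite /int_objective sumE /shifted_value /= addrK; exact: xv.
    + by have [s sn ne] := xx i j ijk; exists s; rewrite // !zE.
(* Values below [- T] fall outside the box, but they can be raised to [- T] because every objective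
   value is at least that; so the box loses no maximum. *)
have low v : values k t v -> values k t (Num.max v (- T)).
  move=> [x [xf xv xx]]; exists x; split=> // i ik.
  rewrite ge_max xv//=; have [_] := HD _ (xf i ik).
  by move: (int_objective _ _) => w; lia.
have qE : (- 'X^D : {poly int}).[t] = - T by rewrite hornerN hornerXn.
move=> [w [wF wmax]|wn] /=.
  have [x [wx xb _]] := wF; have /andP[w0 _] := xb 0%N isT; rewrite -wx in w0.
  rewrite qE mul1r; split=> [|v Vv]; first exact: fwd.
  have := wmax _ (bwd _ (low v Vv) _); rewrite le_max lexx orbT => /(_ isT).
  have : v <= Num.max v (- T) by rewrite le_max lexx.
  by move: (Num.max _ _) => M; lia.
move=> v /low Vv; apply: (wn _ (bwd _ Vv _)); by rewrite le_max lexx orbT.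
Qed.

End IntegerPoints.

Theorem theorem1p3 (R : realType) (n m : nat) (c : 'cV[{poly int}]_n)
    (A : 'M[{poly int}]_(m, n)) (b : 'cV[{poly int}]_m) :
  (0 < n)%N -> (0 < m)%N ->
  (forall t : int, 0 < t -> bounded_set (polyhedron R A b t)) ->
  forall l : nat, (0 < l)%N ->
    eventually_quasi_polynomial [set t : int | 0 < t]
      (param_kth_largest R c A b l).
Proof.
move=> _ _ bounded_polyhedron [//|k] _.
apply: (qmax_eventually_quasi_polynomial (qmax_values c bounded_polyhedron k)).
have := finite_lattice_points c bounded_polyhedron; apply: ev_imp => t finL q.
exact: kth_largest_values.
Qed.
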